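(* Let $D$ be a domain in $\mathbb{C}$ with $C^2$ boundary near a point $p\in\partial D$, and let $f:D\to D$ be a holomorphic map. If $f(z_0)=z_0$ for some $z_0\in D$ and $f(z)=z+o(|z-p|)$ as $z\to p$ non-tangentially, then $f(z)\equiv z$.
   Context: $g(z)=o(h(z))$ as $z\to p$ non-tangentially means that for every $M>1$, $g(z)/h(z)\to0$ as $z\to p$ within $\{z\in D: |z-p|<M\,\mathrm{dist}(z,\partial D)\}$. *)

(* Defs.v *)
From Stdlib Require Export Reals.
From Coquelicot Require Export Coquelicot.
Open Scope R_scope.
Open Scope C_scope.

Definition connected_set (D : C -> Prop) : Prop :=
  forall U V : C -> Prop,
    open U -> open V ->
    (forall z, D z -> U z \/ V z) ->
    (exists z, D z /\ U z) ->
    (exists z, D z /\ V z) ->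
    exists z, D z /\ U z /\ V z.

Definition is_domain (D : C -> Prop) : Prop :=
  (exists z, D z) /\ open D /\ connected_set D.

Definition boundary (D : C -> Prop) (p : C) : Prop :=
  forall eps : R, (0 < eps)%R ->
    (exists z, (Cmod (z - p) < eps)%R /\ D z) /\
    (exists z, (Cmod (z - p) < eps)%R /\ ~ D z).

(* The infimum is a real number as soon as S is nonempty; for S empty it is
   p_infty, which the coercion [real] sends to 0. *)
Definition dist_to (z : C) (S : C -> Prop) : R :=
  real (Glb_Rbar (fun x : R => exists w, S w /\ x = Cmod (z - w))).

(* All k <= 2 are required, since [Derive] is total and [ex_derive_n h 2 x]
   alone does not give differentiability of h. *)
Definition C2_on (h : R -> R) (a b : R) : Prop :=
  forall x : R, (a < x < b)%R ->
    (forall k : nat, (k <= 2)%nat -> ex_derive_n h k x) /\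
    continuous (Derive_n h 2) x.

(* In the coordinates w = s + i t obtained by moving p to the origin and
   rotating by a unimodular u, the part of D in a disc about p is the part of
   the disc lying strictly above the graph t = h(s). *)
Definition C2_boundary_near (D : C -> Prop) (p : C) : Prop :=
  exists (r : R) (u : C) (h : R -> R),
    (0 < r)%R /\ Cmod u = 1%R /\ C2_on h (- r) r /\
    forall w : C, (Cmod w < r)%R -> (D (p + u * w) <-> (h (Re w) < Im w)%R).

Definition holomorphic_on (D : C -> Prop) (f : C -> C) : Prop :=
  forall z : C, D z -> ex_derive (K := C_AbsRing) (V := C_NormedModule) f z.

Definition approach_region (D : C -> Prop) (p : C) (M : R) (z : C) : Prop :=
  D z /\ (Cmod (z - p) < M * dist_to z (boundary D))%R.

Definition nontangential_little_o
    (D : C -> Prop) (p : C) (g h : C -> C) : Prop :=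
  forall M : R, (1 < M)%R ->
    filterlim (fun z : C => g z / h z)
      (within (approach_region D p M) (locally p)) (locally (RtoC 0)).

(* Main.v *)
Require Import Defs.
From Stdlib Require Import Lra Lia ClassicalEpsilon.

(** Since the boundary is smooth at [p], the domain lies outside a disc tangent to it
at [p] and contains the mirror disc ([tangent_discs]).  Inverting at [p] turns
these discs into half-planes: [D] becomes a domain [E] with [{Re z > K}] inside [E] and [E] inside [{Re z > 0}],
[f] becomes a self-map [g] of [E], and [f z = z + o(|z - p|)] becomes
[g z = z + o(|z|)] as [z] tends to infinity in the Stolz region
[|z - x| <= x / 2], [x] real.  This is the setting of [half_plane_rigidity].

All iterates of [g] also satisfy [g^n x = x + o(x)], so each of them, as a map from
[{Re z > K}] to [{Re z > 0}], has angular derivative [1] at infinity, and Julia's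
lemma gives

  [Re (g^n z) >= Re z - K]   when [Re z > K],   with the same [K] for every [n].

No orbit that starts deep in the half-plane can therefore come back to the
neighbourhood of the fixed point [z0].  Let [l] be the multiplier [g' z0], and
let [h z = 1 / (1 + z)], which is injective and bounded by [1] on [E].

- If [l] is not a root of unity, the averages of [h] along orbits converge to [h z0]:
  near [z0] all the Taylor coefficients of positive order of a bounded, almost
  [g]-invariant sequence have to vanish in the limit, because [l ^ m <> 1]; a
  Vitali argument carries the convergence to the whole domain
  ([average_nonresonant]).  But by the inequality above the averages stay close
  to [0] on orbits that start far to the right, and [h z0 <> 0].

- If [l ^ q = 1], then [g^q] is tangent to the identity at [z0], and Cartan's
  uniqueness argument gives [g^q = id] ([tangent_to_identity]).  Near a large
  real [x] the displacement [g z - z] is at most [eps x] and hence has Lipschitz constant of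
  order [eps], so the [q] displacements along an orbit are almost equal.  They add up
  to zero, so each is zero ([periodic_near_identity]), and [g] is the
  identity by the identity theorem.

The complex analysis behind this is built on Cauchy's formula for functions that are
merely complex differentiable ([cauchy_formula]), in the form of a Taylor
expansion with remainder ([taylor_exists]); the Schwarz lemma, the Lipschitz
estimates and the Vitali theorem are read off from such expansions. *)

Local Open Scope R_scope.

(** * Complex derivatives *)

(** The target is the ring [C_AbsRing] seen as a module over itself, the structure in
   which the product and chain rules for derivatives are stated. *)
Definition cderiv (f : C -> C) (z l : C) : Prop :=
  @is_derive C_AbsRing (AbsRing_NormedModule C_AbsRing) f z l.

Lemma cderiv_eps (f : C -> C) (z l : C) :
  cderiv f z l <->
  forall eps, 0 < eps -> exists delta, 0 < delta /\ forall v,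
    Cmod (v - z) < delta ->
    Cmod (f v - f z - l * (v - z)) <= eps * Cmod (v - z).
Proof.
  split.
  - intros [_ H] eps He.
    assert (Hlim : is_filter_lim (@locally (AbsRing_UniformSpace C_AbsRing) z) z)
      by (intros P HP; exact HP).
    destruct (H z Hlim (mkposreal eps He)) as [d Hd].
    exists d; split; [apply cond_pos|]. intros v Hv.
    specialize (Hd v Hv). rewrite (Cmult_comm l). exact Hd.
  - intros H. split.
    + apply @is_linear_scal_l.
    + intros x Hx eps.
      assert (Hzx : z = x).
      { apply (@is_filter_lim_locally_unique C_AbsRing
          (AbsRing_NormedModule C_AbsRing)). exact Hx. }
      subst x.
      destruct (H eps (cond_pos eps)) as [d [Hd Hv]].
      exists (mkposreal d Hd). intros v Hb. specialize (Hv v Hb).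
      rewrite (Cmult_comm l) in Hv. exact Hv.
Qed.

(** In both module structures on [C] the norm is the modulus, so the two notions of derivative agree. *)
Lemma ex_derive_cderiv (f : C -> C) (z : C) :
  ex_derive (K := C_AbsRing) (V := C_NormedModule) f z -> exists l, cderiv f z l.
Proof.
  intros [l [_ H]]. exists l. apply cderiv_eps. intros eps He.
  assert (Hlim : is_filter_lim (@locally (AbsRing_UniformSpace C_AbsRing) z) z)
    by (intros P HP; exact HP).
  destruct (H z Hlim (mkposreal eps He)) as [d Hd].
  exists d; split; [apply cond_pos|]. intros v Hv.
  specialize (Hd v Hv). rewrite (Cmult_comm l). exact Hd.
Qed.

Lemma cderiv_const (c z : C) : cderiv (fun _ => c) z 0.
Proof. exact (@is_derive_const C_AbsRing (AbsRing_NormedModule C_AbsRing) c z). Qed.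

Lemma cderiv_id (z : C) : cderiv (fun v => v) z 1.
Proof. exact (@is_derive_id C_AbsRing z). Qed.

Lemma cderiv_plus (f g : C -> C) z l m :
  cderiv f z l -> cderiv g z m -> cderiv (fun v => f v + g v)%C z (l + m)%C.
Proof. exact (@is_derive_plus C_AbsRing (AbsRing_NormedModule C_AbsRing) f g z l m). Qed.

Lemma cderiv_minus (f g : C -> C) z l m :
  cderiv f z l -> cderiv g z m -> cderiv (fun v => f v - g v)%C z (l - m)%C.
Proof. exact (@is_derive_minus C_AbsRing (AbsRing_NormedModule C_AbsRing) f g z l m). Qed.

Lemma cderiv_mult (f g : C -> C) z l m :
  cderiv f z l -> cderiv g z m ->
  cderiv (fun v => f v * g v)%C z (l * g z + f z * m)%C.
Proof.
  intros Hf Hg.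
  exact (@is_derive_mult C_AbsRing f g z l m Hf Hg Cmult_comm).
Qed.

Lemma cderiv_comp (f g : C -> C) z l m :
  cderiv f (g z) l -> cderiv g z m -> cderiv (fun v => f (g v)) z (m * l)%C.
Proof.
  exact (@is_derive_comp C_AbsRing (AbsRing_NormedModule C_AbsRing) f g z l m).
Qed.

Lemma cderiv_cont (f : C -> C) z l :
  cderiv f z l -> forall eps, 0 < eps -> exists delta, 0 < delta /\ forall v,
    Cmod (v - z) < delta -> Cmod (f v - f z) < eps.
Proof.
  intros H eps He. destruct (proj1 (cderiv_eps f z l) H 1 Rlt_0_1) as [d [Hd Hv]].
  assert (HK : 0 < 1 + Cmod l) by (pose proof (Cmod_ge_0 l); lra).
  exists (Rmin d (eps / (1 + Cmod l))). split.
  { apply Rmin_glb_lt; [exact Hd|]. apply Rdiv_lt_0_compat; lra. }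
  intros v Hlt.
  specialize (Hv v (Rlt_le_trans _ _ _ Hlt (Rmin_l _ _))).
  assert (Hlt2 := Rlt_le_trans _ _ _ Hlt (Rmin_r _ _)).
  replace (f v - f z)%C with ((f v - f z - l * (v - z)) + l * (v - z))%C by ring.
  eapply Rle_lt_trans; [apply Cmod_triangle|]. rewrite Cmod_mult.
  apply Rle_lt_trans with ((1 + Cmod l) * Cmod (v - z)); [lra|].
  replace eps with ((1 + Cmod l) * (eps / (1 + Cmod l))) by (field; lra).
  apply Rmult_lt_compat_l; assumption.
Qed.

Lemma cderiv_inv (z : C) : z <> 0 -> cderiv Cinv z (- / (z * z))%C.
Proof.
  intros Hz. apply cderiv_eps. intros eps He.
  assert (Hm : 0 < Cmod z) by (apply Cmod_gt_0; exact Hz).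
  exists (Rmin (Cmod z / 2) (eps * (Cmod z * Cmod z * Cmod z) / 2)). split.
  { apply Rmin_glb_lt; [lra|].
    assert (0 < Cmod z * Cmod z * Cmod z) by (repeat apply Rmult_lt_0_compat; lra).
    assert (0 < eps * (Cmod z * Cmod z * Cmod z)) by (apply Rmult_lt_0_compat; lra).
    lra. }
  intros v Hv.
  assert (H1 := Rlt_le_trans _ _ _ Hv (Rmin_l _ _)).
  assert (H2 := Rlt_le_trans _ _ _ Hv (Rmin_r _ _)).
  assert (Hvm : Cmod z / 2 < Cmod v).
  { assert (Cmod z <= Cmod v + Cmod (v - z)).
    { replace z with (v + - (v - z))%C at 1 by ring.
      eapply Rle_trans; [apply Cmod_triangle|]. rewrite Cmod_opp; lra. }
    lra. }
  assert (Hv0 : v <> 0) by (apply Cmod_gt_0; lra).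
  replace (/ v - / z - - / (z * z) * (v - z))%C
    with ((v - z) * (v - z) / (v * (z * z)))%C by (field; split; assumption).
  rewrite Cmod_div, !Cmod_mult.
  2: { repeat apply Cmult_neq_0; assumption. }
  apply Rle_trans with (Cmod (v - z) * (Cmod (v - z) / (Cmod z / 2 * (Cmod z * Cmod z)))).
  - unfold Rdiv. rewrite Rmult_assoc. apply Rmult_le_compat_l; [apply Cmod_ge_0|].
    apply Rmult_le_compat_l; [apply Cmod_ge_0|].
    assert (0 < Cmod z * Cmod z) by nra.
    apply Rinv_le_contravar; [nra|]. apply Rmult_le_compat_r; lra.
  - rewrite (Rmult_comm eps). apply Rmult_le_compat_l; [apply Cmod_ge_0|].
    assert (0 < Cmod z * Cmod z) by nra.
    apply Rle_div_l; [nra|]. nra.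
Qed.

Lemma open_Cmod (D : C -> Prop) (z : C) :
  open D -> D z -> exists r, 0 < r /\ forall v, Cmod (v - z) < r -> D v.
Proof.
  intros HD Hz. destruct (HD z Hz) as [d Hd]. exists d. split; [apply cond_pos|].
  intros v Hv. apply Hd. apply C_NormedModule_mixin_compat1. exact Hv.
Qed.

Lemma Cmod_open (D : C -> Prop) :
  (forall z, D z -> exists r, 0 < r /\ forall v, Cmod (v - z) < r -> D v) -> open D.
Proof.
  intros H z Hz. destruct (H z Hz) as [r [Hr Hb]].
  assert (Hs : 0 < sqrt 2) by (apply sqrt_lt_R0; lra).
  exists (mkposreal (r / sqrt 2) (Rdiv_lt_0_compat _ _ Hr Hs)). intros v Hv.
  apply Hb.
  replace r with (sqrt 2 * (r / sqrt 2)) by (field; lra).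
  exact (C_NormedModule_mixin_compat2 z v (mkposreal _ (Rdiv_lt_0_compat _ _ Hr Hs)) Hv).
Qed.

(** * Integrals of complex-valued functions of a real variable *)

(** Continuity is required of the two real components, the form in which integrability is used. *)
Definition ccont (F : R -> C) : Prop :=
  forall t, continuous (fun x => Re (F x)) t /\ continuous (fun x => Im (F x)) t.

Definition CInt (F : R -> C) (a b : R) : C :=
  (RInt (fun x => Re (F x)) a b, RInt (fun x => Im (F x)) a b).

Lemma ccont_eps (F : R -> C) :
  (forall t eps, 0 < eps -> exists delta, 0 < delta /\
     forall x, Rabs (x - t) < delta -> Cmod (F x - F t) < eps) -> ccont F.
Proof.
  intros H t.
  split; apply filterlim_locally; intros [eps He]; destruct (H t eps He) as [d [Hd Hx]];
    exists (mkposreal d Hd); intros x Hb; specialize (Hx x Hb);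
    apply Rle_lt_trans with (2 := Hx); pose proof (Rmax_Cmod (F x - F t)%C) as HM.
  - exact (Rle_trans _ _ _ (Rmax_l _ _) HM).
  - exact (Rle_trans _ _ _ (Rmax_r _ _) HM).
Qed.

Lemma ccont_elim (F : R -> C) t eps : ccont F -> 0 < eps ->
  exists delta, 0 < delta /\
     forall x, Rabs (x - t) < delta -> Cmod (F x - F t) < eps.
Proof.
  intros H He. destruct (H t) as [H1 H2].
  assert (Hs : 0 < eps / 2) by lra.
  apply (proj1 (filterlim_locally _ _)) with (eps := mkposreal _ Hs) in H1.
  apply (proj1 (filterlim_locally _ _)) with (eps := mkposreal _ Hs) in H2.
  destruct H1 as [d1 H1], H2 as [d2 H2].
  exists (Rmin d1 d2). split; [apply Rmin_glb_lt; apply cond_pos|].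
  intros x Hx.
  specialize (H1 x (Rlt_le_trans _ _ _ Hx (Rmin_l _ _))).
  specialize (H2 x (Rlt_le_trans _ _ _ Hx (Rmin_r _ _))).
  change (Rabs (Re (F x) - Re (F t)) < eps / 2) in H1.
  change (Rabs (Im (F x) - Im (F t)) < eps / 2) in H2.
  replace (F x - F t)%C with (RtoC (Re (F x) - Re (F t)) + Ci * RtoC (Im (F x) - Im (F t)))%C.
  2: { destruct (F x), (F t); apply injective_projections; simpl; ring. }
  eapply Rle_lt_trans; [apply Cmod_triangle|].
  rewrite Cmod_mult, Cmod_Ci, !Cmod_R. lra.
Qed.

Lemma ccont_const c : ccont (fun _ => c).
Proof. intros t; split; apply continuous_const. Qed.

Lemma ccont_plus F G : ccont F -> ccont G -> ccont (fun t => F t + G t)%C.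
Proof.
  intros HF HG t. destruct (HF t), (HG t). split.
  - apply (continuous_plus (fun x => Re (F x)) (fun x => Re (G x))); assumption.
  - apply (continuous_plus (fun x => Im (F x)) (fun x => Im (G x))); assumption.
Qed.

Lemma ccont_mult F G : ccont F -> ccont G -> ccont (fun t => F t * G t)%C.
Proof.
  intros HF HG t. destruct (HF t), (HG t). split.
  - apply (continuous_minus (fun x => Re (F x) * Re (G x)) (fun x => Im (F x) * Im (G x)));
      apply (@continuous_mult R_UniformSpace R_AbsRing); assumption.
  - apply (continuous_plus (fun x => Re (F x) * Im (G x)) (fun x => Im (F x) * Re (G x)));
      apply (@continuous_mult R_UniformSpace R_AbsRing); assumption.
Qed.

Lemma ccont_ext F G : (forall t, F t = G t) -> ccont F -> ccont G.
Proof.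
  intros H HF t. destruct (HF t). split.
  - apply continuous_ext with (2 := H0); intros; now rewrite H.
  - apply continuous_ext with (2 := H1); intros; now rewrite H.
Qed.

Lemma ccont_minus F G : ccont F -> ccont G -> ccont (fun t => F t - G t)%C.
Proof.
  intros HF HG.
  apply ccont_ext with (fun t => F t + (RtoC (-1)) * G t)%C.
  - intros t. apply injective_projections; simpl; ring.
  - apply ccont_plus; [assumption|]. apply ccont_mult; [apply ccont_const|assumption].
Qed.

Lemma ccont_comp (f : C -> C) F :
  (forall t, exists l, cderiv f (F t) l) -> ccont F -> ccont (fun t => f (F t)).
Proof.
  intros Hf HF. apply ccont_eps. intros t eps He.
  destruct (Hf t) as [l Hl].
  destruct (cderiv_cont _ _ _ Hl eps He) as [d [Hd H]].
  destruct (ccont_elim F t d HF Hd) as [d' [Hd' H']].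
  exists d'; split; [assumption|]. intros x Hx. apply H, H', Hx.
Qed.

Lemma ccont_inv (F : R -> C) : (forall t, F t <> 0) -> ccont F -> ccont (fun t => / F t)%C.
Proof.
  intros H0 HF. apply ccont_comp; [|assumption].
  intros t. eexists. apply cderiv_inv, H0.
Qed.

Lemma ccont_RtoC (g : R -> R) : (forall t, continuous g t) -> ccont (fun t => RtoC (g t)).
Proof. intros H t. split; [apply H|apply continuous_const]. Qed.

Lemma ccont_ex F a b : ccont F ->
  ex_RInt (fun x => Re (F x)) a b /\ ex_RInt (fun x => Im (F x)) a b.
Proof.
  intros H; split; apply (@ex_RInt_continuous R_CompleteNormedModule); intros; apply H.
Qed.

Lemma CInt_plus F G a b : ccont F -> ccont G ->
  CInt (fun t => F t + G t)%C a b = (CInt F a b + CInt G a b)%C.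
Proof.
  intros HF HG. destruct (ccont_ex F a b HF), (ccont_ex G a b HG).
  apply injective_projections; simpl.
  - exact (RInt_plus (fun x => Re (F x)) (fun x => Re (G x)) a b H H1).
  - exact (RInt_plus (fun x => Im (F x)) (fun x => Im (G x)) a b H0 H2).
Qed.

Lemma CInt_scal c F a b : ccont F -> CInt (fun t => c * F t)%C a b = (c * CInt F a b)%C.
Proof.
  intros HF. destruct (ccont_ex F a b HF) as [H1 H2].
  apply injective_projections; simpl.
  - rewrite <- (RInt_scal (V := R_CompleteNormedModule) _ a b (fst c) H1 :
      _ = fst c * _).
    rewrite <- (RInt_scal (V := R_CompleteNormedModule) _ a b (snd c) H2 :
      _ = snd c * _).
    apply (RInt_minus (V := R_CompleteNormedModule)
      (fun x => fst c * Re (F x)) (fun x => snd c * Im (F x)));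
     apply (ex_RInt_scal (V := R_CompleteNormedModule)); assumption.
  - rewrite <- (RInt_scal (V := R_CompleteNormedModule) _ a b (fst c) H2 :
      _ = fst c * _).
    rewrite <- (RInt_scal (V := R_CompleteNormedModule) _ a b (snd c) H1 :
      _ = snd c * _).
    apply (RInt_plus (V := R_CompleteNormedModule)
      (fun x => fst c * Im (F x)) (fun x => snd c * Re (F x)));
     apply (ex_RInt_scal (V := R_CompleteNormedModule)); assumption.
Qed.

Lemma CInt_ext F G a b : (forall t, F t = G t) -> CInt F a b = CInt G a b.
Proof.
  intros H. unfold CInt. f_equal; apply (RInt_ext (V := R_CompleteNormedModule));
  intros; now rewrite H.
Qed.

Lemma CInt_minus F G a b : ccont F -> ccont G ->
  CInt (fun t => F t - G t)%C a b = (CInt F a b - CInt G a b)%C.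
Proof.
  intros HF HG.
  rewrite (CInt_ext _ (fun t => F t + RtoC (-1) * G t)%C).
  - rewrite CInt_plus, CInt_scal; trivial.
    + apply injective_projections; simpl; ring.
    + apply ccont_mult; [apply ccont_const|assumption].
  - intros t. apply injective_projections; simpl; ring.
Qed.

Lemma CInt_Chasles F a b c : ccont F -> CInt F a c = (CInt F a b + CInt F b c)%C.
Proof.
  intros HF. destruct (ccont_ex F a b HF), (ccont_ex F b c HF).
  apply injective_projections; simpl; symmetry;
   apply (RInt_Chasles (V := R_CompleteNormedModule)); assumption.
Qed.

Lemma CInt_bound F a b M : ccont F -> a <= b ->
  (forall t, a <= t <= b -> Cmod (F t) <= M) -> Cmod (CInt F a b) <= (b - a) * M.
Proof.
  intros HF Hab HM. destruct (ccont_ex F a b HF) as [H1 H2].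
  assert (HI : is_RInt (V := prod_NormedModule R_AbsRing R_NormedModule R_NormedModule)
     F a b (CInt F a b)).
  { apply is_RInt_fct_extend_pair.
    - exact (RInt_correct (V := R_CompleteNormedModule) _ a b H1).
    - exact (RInt_correct (V := R_CompleteNormedModule) _ a b H2). }
  rewrite Cmod_norm.
  apply (norm_RInt_le_const (V := prod_NormedModule R_AbsRing R_NormedModule R_NormedModule)
    F a b _ M Hab); [|exact HI].
  intros x Hx. specialize (HM x Hx). rewrite Cmod_norm in HM. exact HM.
Qed.

Lemma CInt_derive G F a b : ccont F ->
  (forall t, is_derive (fun x => Re (G x)) t (Re (F t)) /\
             is_derive (fun x => Im (G x)) t (Im (F t))) ->
  CInt F a b = (G b - G a)%C.
Proof.
  intros HF HG.
  apply injective_projections; simpl; apply (is_RInt_unique (V := R_CompleteNormedModule)).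
  - apply (is_RInt_derive (V := R_CompleteNormedModule) (fun x => Re (G x)) (fun x => Re (F x))).
    + intros; apply HG.
    + intros; apply HF.
  - apply (is_RInt_derive (V := R_CompleteNormedModule) (fun x => Im (G x)) (fun x => Im (F x))).
    + intros; apply HG.
    + intros; apply HF.
Qed.

Lemma CInt_conj F a b : ccont F -> CInt (fun t => Cconj (F t)) a b = Cconj (CInt F a b).
Proof.
  intros HF. destruct (ccont_ex F a b HF) as [H1 H2].
  apply injective_projections; simpl; [reflexivity|].
  exact (RInt_opp (V := R_CompleteNormedModule) (fun x => Im (F x)) a b H2).
Qed.

(** * Bisection of rectangles *)

Section Bisection.

Variable J : R -> R -> R -> R -> C.
Hypothesis J_split1 : forall a m b c d, J a b c d = (J a m c d + J m b c d)%C.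
Hypothesis J_split2 : forall a b c m d, J a b c d = (J a b c m + J a b m d)%C.
Hypothesis J_local : forall u v eps, 0 < eps -> exists delta, 0 < delta /\
  forall a b c d, a <= u <= b -> c <= v <= d -> b - a < delta -> d - c < delta ->
  Cmod (J a b c d) <= eps * ((b - a) + (d - c)) ^ 2.

Let rect : Type := (R * R * R * R)%type.
Let sub (s s' : rect) : Prop :=
  let '(a, b, c, d) := s in let '(a', b', c', d') := s' in
  a <= b -> c <= d ->
  (a <= a' /\ a' <= b' /\ b' <= b) /\ (c <= c' /\ c' <= d' /\ d' <= d) /\
  b' - a' = (b - a) / 2 /\ d' - c' = (d - c) / 2 /\
  Cmod (J a b c d) <= 4 * Cmod (J a' b' c' d').

Lemma halving_choice (x y z : C) : z = (x + y)%C ->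
  Cmod z <= 2 * Cmod x \/ Cmod z <= 2 * Cmod y.
Proof.
  intros ->. pose proof (Cmod_triangle x y).
  destruct (Rle_dec (Cmod x) (Cmod y)); [right|left]; lra.
Qed.

Lemma quarter_choice (s : rect) : exists s', sub s s'.
Proof.
  destruct s as [[[a b] c] d]. pose (m := (a + b) / 2). pose (n := (c + d) / 2).
  assert (H1 : exists a' b', (a' = a /\ b' = m \/ a' = m /\ b' = b) /\
     Cmod (J a b c d) <= 2 * Cmod (J a' b' c d)).
  { destruct (halving_choice _ _ _ (J_split1 a m b c d)); eauto 10. }
  destruct H1 as [a' [b' [Hab HJ1]]].
  assert (H2 : exists c' d', (c' = c /\ d' = n \/ c' = n /\ d' = d) /\
     Cmod (J a' b' c d) <= 2 * Cmod (J a' b' c' d')).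
  { destruct (halving_choice _ _ _ (J_split2 a' b' c n d)); eauto 10. }
  destruct H2 as [c' [d' [Hcd HJ2]]].
  exists (a', b', c', d'). unfold sub. intros Ha Hc.
  unfold m, n in *.
  repeat split; try lra;
   destruct Hab as [[-> ->]|[-> ->]]; destruct Hcd as [[-> ->]|[-> ->]]; lra.
Qed.

(** Goursat's argument for an additive function [J] of rectangles.  Repeated
   quartering, each time keeping a quarter on which [J] is at least a quarter of the previous value,
   leads to a point at which the local estimate, quadratic in the side
   lengths with an arbitrarily small constant, is contradicted unless [J] vanishes. *)
Lemma bisection_zero A B U V : A <= B -> U <= V -> J A B U V = 0.
Proof.
  intros HAB HUV.
  pose (next := fun s => proj1_sig (constructive_indefinite_description _ (quarter_choice s))).
  assert (Hnext : forall s, sub s (next s)).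
  { intros s. exact (proj2_sig (constructive_indefinite_description _ (quarter_choice s))). }
  pose (s := fun n => Nat.iter n next (A, B, U, V)).
  pose (a := fun n => let '(a, b, c, d) := s n in a).
  pose (b := fun n => let '(a, b, c, d) := s n in b).
  pose (c := fun n => let '(a, b, c, d) := s n in c).
  pose (d := fun n => let '(a, b, c, d) := s n in d).
  assert (Hs : forall n, (a n <= b n /\ c n <= d n) /\
     (a n <= a (S n) /\ b (S n) <= b n) /\ (c n <= c (S n) /\ d (S n) <= d n) /\
     b n - a n = (B - A) / 2 ^ n /\ d n - c n = (V - U) / 2 ^ n /\
     Cmod (J A B U V) <= 4 ^ n * Cmod (J (a n) (b n) (c n) (d n))).
  { assert (Hstep : forall n, a n <= b n -> c n <= d n ->
      (a n <= a (S n) /\ a (S n) <= b (S n) /\ b (S n) <= b n) /\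
      (c n <= c (S n) /\ c (S n) <= d (S n) /\ d (S n) <= d n) /\
      b (S n) - a (S n) = (b n - a n) / 2 /\ d (S n) - c (S n) = (d n - c n) / 2 /\
      Cmod (J (a n) (b n) (c n) (d n)) <=
        4 * Cmod (J (a (S n)) (b (S n)) (c (S n)) (d (S n)))).
    { intros n. pose proof (Hnext (s n)) as Hn. change (next (s n)) with (s (S n)) in Hn.
      unfold a, b, c, d. destruct (s n) as [[[a0 b0] c0] d0].
      destruct (s (S n)) as [[[a1 b1] c1] d1]. exact Hn. }
    induction n as [|n IH].
    - destruct (Hstep 0%nat) as (H1 & H2 & _); [exact HAB|exact HUV|].
      repeat split; try tauto; try (unfold a, b, c, d; simpl; lra).
    - destruct IH as ((Hab & Hcd) & _ & _ & Hl1 & Hl2 & HJ).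
      destruct (Hstep n Hab Hcd) as ((? & ? & ?) & (? & ? & ?) & E1 & E2 & HJ').
      destruct (Hstep (S n)) as ((? & ? & ?) & (? & ? & ?) & _); [assumption..|].
      assert (Hp : 2 ^ n <> 0) by (apply pow_nonzero; lra).
      repeat split; try assumption.
      + rewrite E1, Hl1; simpl; field; assumption.
      + rewrite E2, Hl2; simpl; field; assumption.
      + eapply Rle_trans; [exact HJ|]. simpl.
        rewrite (Rmult_comm 4), Rmult_assoc. apply Rmult_le_compat_l; [|exact HJ'].
        apply pow_le; lra. }
  assert (Hlim : forall x y : nat -> R, (forall n, x n <= y n) ->
     (forall n, x n <= x (S n)) -> (forall n, y (S n) <= y n) ->
     exists u, forall n, x n <= u <= y n).
  { intros x y Hxy Hx Hy.
    assert (Hxm : forall n k, x n <= x (k + n)%nat).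
    { intros n k; induction k; simpl; [lra|]. eapply Rle_trans; [exact IHk|apply Hx]. }
    assert (Hym : forall n k, y (k + n)%nat <= y n).
    { intros n k; induction k; simpl; [lra|]. eapply Rle_trans; [apply Hy|exact IHk]. }
    assert (Hall : forall n m, x n <= y m).
    { intros n m. apply Rle_trans with (x (m + n)%nat); [apply Hxm|].
      apply Rle_trans with (y (m + n)%nat); [apply Hxy|].
      rewrite Nat.add_comm. apply Hym. }
    destruct (completeness (fun z => exists n, z = x n)) as [u [Hu1 Hu2]].
    - exists (y 0%nat). intros z [n ->]. apply Hall.
    - exists (x 0%nat), 0%nat; reflexivity.
    - exists u. intros n. split.
      + apply Hu1. now exists n.
      + apply Hu2. intros z [m ->]. apply Hall. }
  destruct (Hlim a b) as [u Hu]; try (intro n; apply (Hs n)).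
  destruct (Hlim c d) as [v Hv]; try (intro n; apply (Hs n)).
  apply Cmod_eq_0. apply Rle_antisym; [|apply Cmod_ge_0].
  apply le_epsilon. intros eps He. rewrite Rplus_0_l.
  pose (K := (B - A) + (V - U)).
  assert (HK : 0 <= K ^ 2) by apply pow2_ge_0.
  (* After [n] steps the side lengths add up to [K / 2 ^ n] while [J] has lost at most
     the factor [4 ^ n]; with this constant the total is at most [eps]. *)
  destruct (J_local u v (eps / (K ^ 2 + 1))) as [delta [Hd Hloc]].
  { apply Rdiv_lt_0_compat; lra. }
  destruct (Pow_x_infinity 2) with (b := (K + 1) / delta) as [n Hn].
  { rewrite Rabs_right; lra. }
  specialize (Hn n (Nat.le_refl n)).
  assert (H2n : 0 < 2 ^ n) by (apply pow_lt; lra).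
  rewrite Rabs_right in Hn by lra.
  assert (Hlt : K / 2 ^ n < delta).
  { apply Rlt_div_l; [lra|]. apply Rge_le in Hn. apply Rle_div_l in Hn; [|lra]. lra. }
  destruct (Hs n) as ((? & ?) & _ & _ & Hl1 & Hl2 & HJ).
  eapply Rle_trans; [exact HJ|].
  assert (Hbd : Cmod (J (a n) (b n) (c n) (d n)) <=
     eps / (K ^ 2 + 1) * (K / 2 ^ n) ^ 2).
  { replace (K / 2 ^ n) with ((b n - a n) + (d n - c n))
      by (rewrite Hl1, Hl2; unfold K; field; lra).
    apply Hloc; try apply Hu; try apply Hv.
    - apply Rle_lt_trans with (2 := Hlt). replace (K / 2 ^ n) with ((b n - a n) + (d n - c n))
      by (rewrite Hl1, Hl2; unfold K; field; lra). lra.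
    - apply Rle_lt_trans with (2 := Hlt). replace (K / 2 ^ n) with ((b n - a n) + (d n - c n))
      by (rewrite Hl1, Hl2; unfold K; field; lra). lra. }
  apply Rle_trans with (4 ^ n * (eps / (K ^ 2 + 1) * (K / 2 ^ n) ^ 2)).
  { apply Rmult_le_compat_l; [apply pow_le; lra|exact Hbd]. }
  replace (4 ^ n) with (2 ^ n * 2 ^ n) by (rewrite <- Rpow_mult_distr; f_equal; lra).
  replace (2 ^ n * 2 ^ n * (eps / (K ^ 2 + 1) * (K / 2 ^ n) ^ 2)) with
    (eps * (K ^ 2 / (K ^ 2 + 1))) by (field; lra).
  rewrite <- (Rmult_1_r eps) at 2. apply Rmult_le_compat_l; [lra|].
  apply Rle_div_l; lra.
Qed.

End Bisection.

(** * The Cauchy formula on a circle *)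

Definition expi (t : R) : C := (cos t, sin t).

Lemma Cmod_expi t : Cmod (expi t) = 1.
Proof.
  unfold Cmod, expi; simpl. transitivity (sqrt 1); [f_equal|apply sqrt_1].
  pose proof (sin2_cos2 t) as H. unfold Rsqr in H. lra.
Qed.

Lemma Cmod_le_Re_Im (z : C) : Cmod z <= Rabs (Re z) + Rabs (Im z).
Proof.
  replace z with (RtoC (Re z) + Ci * RtoC (Im z))%C at 1.
  - eapply Rle_trans; [apply Cmod_triangle|]. rewrite Cmod_mult, Cmod_Ci, !Cmod_R. lra.
  - destruct z; apply injective_projections; simpl; ring.
Qed.

Lemma Cmod_minus_sym (a b : C) : Cmod (a - b) = Cmod (b - a).
Proof. rewrite <- Cmod_opp. f_equal. ring. Qed.

Lemma Cmod_minus_le (a b : C) : Cmod (a - b) <= Cmod a + Cmod b.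
Proof. unfold Cminus. rewrite <- (Cmod_opp b). apply Cmod_triangle. Qed.

Lemma Cminus_eq_0 (a b : C) : (a - b)%C = 0 -> a = b.
Proof. intros H. replace a with ((a - b) + b)%C by ring. rewrite H. ring. Qed.

Lemma Cmod_rev_triangle (a b : C) : Cmod a - Cmod b <= Cmod (a - b).
Proof.
  assert (Cmod a <= Cmod (a - b) + Cmod b); [|lra].
  replace a with ((a - b) + b)%C at 1 by ring. apply Cmod_triangle.
Qed.

Lemma is_derive_cont (g : R -> R) x l : is_derive g x l -> continuity_pt g x.
Proof.
  intros H. apply derivable_continuous_pt. exists l. apply is_derive_Reals. exact H.
Qed.

Lemma lipschitz_of_derive (g dg : R -> R) L :
  (forall x, is_derive g x (dg x)) -> (forall x, Rabs (dg x) <= L) ->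
  forall x y, Rabs (g x - g y) <= L * Rabs (x - y).
Proof.
  intros Hd HL x y.
  destruct (MVT_gen g y x dg) as [c [_ Hc]].
  - intros; apply Hd.
  - intros z _. exact (is_derive_cont _ _ _ (Hd z)).
  - rewrite Hc, Rabs_mult. apply Rmult_le_compat_r; [apply Rabs_pos|apply HL].
Qed.

Lemma expi_lipschitz s t : Cmod (expi s - expi t) <= 2 * Rabs (s - t).
Proof.
  eapply Rle_trans; [apply Cmod_le_Re_Im|]. simpl.
  assert (Rabs (cos s - cos t) <= 1 * Rabs (s - t)).
  { apply lipschitz_of_derive with (fun x => - sin x).
    - intros; auto_derive; [trivial|ring].
    - intros z. rewrite Rabs_Ropp. pose proof (SIN_bound z). apply Rabs_le; lra. }
  assert (Rabs (sin s - sin t) <= 1 * Rabs (s - t)).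
  { apply lipschitz_of_derive with cos.
    - intros; auto_derive; [trivial|ring].
    - intros z. pose proof (COS_bound z). apply Rabs_le; lra. }
  unfold Rminus in *. lra.
Qed.

Lemma expi_cont : ccont expi.
Proof.
  intros t; split; apply (@ex_derive_continuous R_AbsRing R_NormedModule);
    unfold expi; simpl; auto_derive; trivial.
Qed.

Lemma CInt_expi a b : CInt expi a b = (- Ci * (expi b - expi a))%C.
Proof.
  rewrite (CInt_derive (fun t => - Ci * expi t)%C expi a b expi_cont).
  - ring.
  - intros t; split; unfold expi; simpl; auto_derive; trivial; ring.
Qed.

(** The factor by which the circle is contracted towards [w].  It is [1] at [s = 0],
   tends to [0] without vanishing, and is smooth with values in (0, 1] for all real [s],
   so that the contracted circles stay in the closed disc and no one-sided derivatives occur. *)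
Definition shrink (s : R) : R := exp (- (s * s)).

Lemma shrink_bounds s : 0 < shrink s <= 1.
Proof.
  unfold shrink. split; [apply exp_pos|]. rewrite <- exp_0.
  assert (0 <= s * s) by nra.
  destruct (Req_dec (s * s) 0) as [->|]; [rewrite Ropp_0; lra|].
  left. apply exp_increasing. lra.
Qed.

Lemma shrink_derive s : is_derive shrink s (- 2 * s * shrink s).
Proof. unfold shrink. auto_derive; trivial. ring. Qed.

Lemma shrink_lipschitz s t : Rabs (shrink s - shrink t) <= Rabs (s - t).
Proof.
  rewrite <- (Rmult_1_l (Rabs (s - t))).
  apply lipschitz_of_derive with (fun x => - 2 * x * shrink x); [apply shrink_derive|].
  intros x. rewrite Rabs_mult, (Rabs_pos_eq (shrink x)) by apply Rlt_le, shrink_bounds.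
  unfold shrink. rewrite exp_Ropp.
  assert (H := exp_ineq1_le (x * x)).
  apply Rle_div_l; [apply exp_pos|].
  assert (H1 := Rle_0_sqr (x - 1)). assert (H2 := Rle_0_sqr (x + 1)). unfold Rsqr in H1, H2.
  assert (Rabs (- 2 * x) <= 1 + x * x); [apply Rabs_le; lra|lra].
Qed.

Definition circle (r t : R) : C := (RtoC r * expi t)%C.

(** This is the Cauchy kernel [dz / (z - w)] on the circle, divided by [i]. *)
Definition cauchy_kern (r : R) (w : C) (t : R) : C := (circle r t / (circle r t - w))%C.

Section Cauchy.

Variables (f : C -> C) (r : R) (w : C).
Hypothesis f_diff : forall z, Cmod z <= r -> exists l, cderiv f z l.
Hypothesis w_in : Cmod w < r.

Let homot (s t : R) : C := (w + RtoC (shrink s) * (circle r t - w))%C.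
Let mu (s : R) : C := RtoC (- 2 * s).

Lemma radius_pos : 0 < r.
Proof. apply Rle_lt_trans with (2 := w_in), Cmod_ge_0. Qed.

Lemma Cmod_circle t : Cmod (circle r t) = r.
Proof.
  unfold circle. rewrite Cmod_mult, Cmod_expi, Cmod_R, Rabs_pos_eq; [ring|].
  apply Rlt_le, radius_pos.
Qed.

Lemma circle_w_lower t : r - Cmod w <= Cmod (circle r t - w).
Proof. rewrite <- (Cmod_circle t) at 1. apply Cmod_rev_triangle. Qed.

Lemma circle_w_upper t : Cmod (circle r t - w) <= 2 * r.
Proof. eapply Rle_trans; [apply Cmod_minus_le|]. rewrite Cmod_circle. lra. Qed.

Lemma circle_w_neq t : (circle r t - w <> 0)%C.
Proof. apply Cmod_gt_0. pose proof (circle_w_lower t). lra. Qed.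

Lemma cauchy_kern_bound t : Cmod (cauchy_kern r w t) <= r / (r - Cmod w).
Proof.
  unfold cauchy_kern. rewrite Cmod_div by apply circle_w_neq. rewrite Cmod_circle.
  apply Rmult_le_compat_l; [apply Rlt_le, radius_pos|].
  apply Rinv_le_contravar; [lra|apply circle_w_lower].
Qed.

Lemma circle_cont : ccont (circle r).
Proof. apply ccont_mult; [apply ccont_const|apply expi_cont]. Qed.

Lemma cauchy_kern_cont : ccont (cauchy_kern r w).
Proof.
  apply ccont_mult; [apply circle_cont|].
  apply ccont_inv; [apply circle_w_neq|].
  apply ccont_minus; [apply circle_cont|apply ccont_const].
Qed.

Lemma mu_cont : ccont mu.
Proof.
  apply ccont_RtoC. intros t. apply (@ex_derive_continuous R_AbsRing R_NormedModule).
  auto_derive; trivial.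
Qed.

Lemma shrink_cont : ccont (fun s => RtoC (shrink s)).
Proof.
  apply ccont_RtoC. intros t. apply (@ex_derive_continuous R_AbsRing R_NormedModule).
  eexists; apply shrink_derive.
Qed.

Lemma homot_cont1 s : ccont (homot s).
Proof.
  apply ccont_plus; [apply ccont_const|].
  apply ccont_mult; [apply ccont_const|].
  apply ccont_minus; [apply circle_cont|apply ccont_const].
Qed.

Lemma homot_cont2 t : ccont (fun s => homot s t).
Proof.
  apply ccont_plus; [apply ccont_const|].
  apply ccont_mult; [apply shrink_cont|apply ccont_const].
Qed.

Lemma Cmod_homot s t : Cmod (homot s t) <= r.
Proof.
  pose proof (shrink_bounds s) as Hg.
  replace (homot s t) with (RtoC (1 - shrink s) * w + RtoC (shrink s) * circle r t)%C.
  2: { unfold homot. rewrite RtoC_minus. ring. }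
  eapply Rle_trans; [apply Cmod_triangle|].
  rewrite !Cmod_mult, !Cmod_R, Cmod_circle, !Rabs_pos_eq by lra.
  pose proof (Cmod_ge_0 w). nra.
Qed.

Lemma homot_lipschitz s t u v :
  Cmod (homot s t - homot u v) <= 2 * r * (Rabs (s - u) + Rabs (t - v)).
Proof.
  replace (homot s t - homot u v)%C with
    (RtoC (shrink s - shrink u) * (circle r t - w) + RtoC (shrink u) * (RtoC r * (expi t - expi v)))%C.
  2: { unfold homot, circle. rewrite RtoC_minus. ring. }
  eapply Rle_trans; [apply Cmod_triangle|].
  rewrite !Cmod_mult, !Cmod_R.
  pose proof (shrink_bounds u). pose proof radius_pos.
  rewrite (Rabs_pos_eq (shrink u)), (Rabs_pos_eq r) by lra.
  pose proof (shrink_lipschitz s u). pose proof (expi_lipschitz t v).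
  pose proof (circle_w_upper t). pose proof (Rabs_pos (shrink s - shrink u)).
  pose proof (Cmod_ge_0 (expi t - expi v)).
  assert (Rabs (shrink s - shrink u) * Cmod (circle r t - w) <= Rabs (s - u) * (2 * r)).
  { apply Rmult_le_compat; try lra. apply Cmod_ge_0. }
  assert (shrink u * (r * Cmod (expi t - expi v)) <= 1 * (r * (2 * Rabs (t - v)))).
  { apply Rmult_le_compat; try lra. apply Rmult_le_pos; lra.
    apply Rmult_le_compat_l; lra. }
  lra.
Qed.

(* The integral of [A dz / (i (z - w))] over the boundary of a parameter rectangle:
   along the contraction [dz / (z - w)] is [- 2 s ds]. *)
Let flux (A : R -> R -> C) (a b c d : R) : C :=
  (CInt (fun t => (A b t - A a t) * cauchy_kern r w t) c d +
   Ci * CInt (fun s => (A s d - A s c) * mu s) a b)%C.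

Let cont2 (A : R -> R -> C) : Prop :=
  (forall s, ccont (A s)) /\ (forall t, ccont (fun s => A s t)).

Lemma flux_cont A a b c d : cont2 A ->
  ccont (fun t => (A b t - A a t) * cauchy_kern r w t)%C /\
  ccont (fun s => (A s d - A s c) * mu s)%C.
Proof.
  intros [H1 H2]. split; apply ccont_mult.
  - apply ccont_minus; apply H1.
  - apply cauchy_kern_cont.
  - apply ccont_minus; apply H2.
  - apply mu_cont.
Qed.

Lemma flux_split1 A a m b c d : cont2 A ->
  flux A a b c d = (flux A a m c d + flux A m b c d)%C.
Proof.
  intros HA. unfold flux.
  rewrite (CInt_Chasles _ a m b) by (apply (flux_cont A a b c d HA)).
  rewrite (CInt_ext (fun t => (A b t - A a t) * cauchy_kern r w t)%C
    (fun t => (A m t - A a t) * cauchy_kern r w t + (A b t - A m t) * cauchy_kern r w t)%C)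
    by (intros; ring).
  rewrite CInt_plus; [ring|apply (flux_cont A a m c d HA)|apply (flux_cont A m b c d HA)].
Qed.

Lemma flux_split2 A a b c m d : cont2 A ->
  flux A a b c d = (flux A a b c m + flux A a b m d)%C.
Proof.
  intros HA. unfold flux.
  rewrite (CInt_Chasles _ c m d) by (apply (flux_cont A a b c d HA)).
  rewrite (CInt_ext (fun s => (A s d - A s c) * mu s)%C
    (fun s => (A s m - A s c) * mu s + (A s d - A s m) * mu s)%C)
    by (intros; ring).
  rewrite CInt_plus; [ring|apply (flux_cont A a b c m HA)|apply (flux_cont A a b m d HA)].
Qed.

(** Affine functions are the ones for which the closedness of the form [f dz / (z - w)]
   can be seen by direct integration. *)
Lemma flux_affine k l a b c d : flux (fun s t => k + l * homot s t)%C a b c d = 0.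
Proof.
  unfold flux.
  rewrite (CInt_ext _ (fun t => (l * RtoC (shrink b - shrink a) * RtoC r) * expi t)%C).
  2: { intros t. pose proof (circle_w_neq t).
       transitivity (l * RtoC (shrink b - shrink a) * circle r t)%C; [|unfold circle; ring].
       unfold homot, cauchy_kern. rewrite RtoC_minus. field. assumption. }
  rewrite CInt_scal by apply expi_cont. rewrite CInt_expi.
  rewrite (CInt_ext (fun s => _ * mu s)%C
    (fun s => (l * RtoC r * (expi d - expi c)) * RtoC (- 2 * s * shrink s))%C).
  2: { intros s. unfold homot, mu, circle. rewrite (RtoC_mult (-2 * s)). ring. }
  assert (Hc : ccont (fun s => RtoC (- 2 * s * shrink s))).
  { apply ccont_ext with (fun s => mu s * RtoC (shrink s))%C.
    - intros; unfold mu; now rewrite (RtoC_mult (-2 * t)).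
    - apply ccont_mult; [apply mu_cont|apply shrink_cont]. }
  rewrite CInt_scal by exact Hc.
  rewrite (CInt_derive (fun s => RtoC (shrink s)) _ a b Hc).
  - rewrite RtoC_minus. ring.
  - intros t; split; [apply shrink_derive|].
    simpl. apply (is_derive_const (K := R_AbsRing) (V := R_NormedModule)).
Qed.

Lemma flux_bound A a b c d m M : cont2 A -> a <= b -> c <= d -> 0 <= m -> 0 <= M ->
  (forall s t, a <= s <= b -> c <= t <= d -> Cmod (A s t) <= m) ->
  (forall s, a <= s <= b -> Cmod (mu s) <= M) ->
  Cmod (flux A a b c d) <= 2 * m * (r / (r - Cmod w) + M) * ((b - a) + (d - c)).
Proof.
  intros HA Hab Hcd Hm HM HAm Hmu. unfold flux.
  destruct (flux_cont A a b c d HA) as [Hc1 Hc2].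
  set (B := r / (r - Cmod w)).
  assert (HB : 0 <= B).
  { apply Rlt_le, Rdiv_lt_0_compat; [apply radius_pos|lra]. }
  eapply Rle_trans; [apply Cmod_triangle|]. rewrite Cmod_mult, Cmod_Ci, Rmult_1_l.
  assert (H1 : Cmod (CInt (fun t => (A b t - A a t) * cauchy_kern r w t)%C c d) <= (d - c) * (2 * m * B)).
  { apply CInt_bound; try assumption. intros t Ht. rewrite Cmod_mult.
    apply Rmult_le_compat; try apply Cmod_ge_0; [|apply cauchy_kern_bound].
    eapply Rle_trans; [apply Cmod_minus_le|].
    assert (Cmod (A b t) <= m) by (apply HAm; lra).
    assert (Cmod (A a t) <= m) by (apply HAm; lra). lra. }
  assert (H2 : Cmod (CInt (fun s => (A s d - A s c) * mu s)%C a b) <= (b - a) * (2 * m * M)).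
  { apply CInt_bound; try assumption. intros t Ht. rewrite Cmod_mult.
    apply Rmult_le_compat; try apply Cmod_ge_0; [|apply Hmu; assumption].
    eapply Rle_trans; [apply Cmod_minus_le|].
    assert (Cmod (A t d) <= m) by (apply HAm; lra).
    assert (Cmod (A t c) <= m) by (apply HAm; lra). lra. }
  assert (0 <= m * B) by nra. assert (0 <= m * M) by nra. nra.
Qed.

Let pull (s t : R) : C := f (homot s t).

Lemma pull_cont : cont2 pull.
Proof.
  split; intros; apply ccont_comp.
  - intros; apply f_diff, Cmod_homot.
  - apply homot_cont1.
  - intros; apply f_diff, Cmod_homot.
  - apply homot_cont2.
Qed.

(** Near a parameter point [f] is affine up to an error that is small compared with
   the distance, and the affine part does not contribute. *)
Lemma flux_local u v eps : 0 < eps -> exists delta, 0 < delta /\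
  forall a b c d, a <= u <= b -> c <= v <= d -> b - a < delta -> d - c < delta ->
  Cmod (flux pull a b c d) <= eps * ((b - a) + (d - c)) ^ 2.
Proof.
  intros He. pose proof radius_pos as Hr.
  destruct (f_diff (homot u v) (Cmod_homot u v)) as [l Hl].
  set (B := r / (r - Cmod w)).
  assert (HB : 0 <= B) by (apply Rlt_le, Rdiv_lt_0_compat; lra).
  (* For [|s - u| <= 1] the logarithmic derivative [- 2 s] of the contraction
     factor is bounded by [M]. *)
  set (M := 2 * (Rabs u + 1)).
  assert (HM : 0 < M) by (pose proof (Rabs_pos u); unfold M; lra).
  set (K := 2 * (2 * r) * (B + M)).
  assert (HK : 0 < K) by (unfold K; nra).
  destruct (proj1 (cderiv_eps _ _ _) Hl (eps / K)) as [d0 [Hd0 H0]].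
  { apply Rdiv_lt_0_compat; lra. }
  exists (Rmin 1 (d0 / (4 * r))). split.
  { apply Rmin_glb_lt; [lra|]. apply Rdiv_lt_0_compat; lra. }
  intros a b c d Hu Hv Hab Hcd.
  assert (b - a < 1) by (apply Rlt_le_trans with (1 := Hab), Rmin_l).
  assert (b - a < d0 / (4 * r)) by (apply Rlt_le_trans with (1 := Hab), Rmin_r).
  assert (d - c < d0 / (4 * r)) by (apply Rlt_le_trans with (1 := Hcd), Rmin_r).
  set (rho := fun s t => (pull s t - (f (homot u v) - l * homot u v + l * homot s t))%C).
  assert (Hsum : flux pull a b c d = flux rho a b c d).
  { assert (Haff : cont2 (fun s t => f (homot u v) - l * homot u v + l * homot s t)%C).
    { split; intros; (apply ccont_plus; [apply ccont_const|]);
       (apply ccont_mult; [apply ccont_const|]); [apply homot_cont1|apply homot_cont2]. }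
    pose proof (flux_cont _ a b c d Haff) as [Ha1 Ha2].
    pose proof (flux_cont _ a b c d pull_cont) as [Hp1 Hp2].
    transitivity (flux pull a b c d -
      flux (fun s t => f (homot u v) - l * homot u v + l * homot s t)%C a b c d)%C.
    { rewrite flux_affine. ring. }
    symmetry. unfold flux.
    rewrite (CInt_ext (fun t => (rho b t - rho a t) * cauchy_kern r w t)%C
      (fun t => ((pull b t - pull a t) * cauchy_kern r w t -
        ((f (homot u v) - l * homot u v + l * homot b t) -
         (f (homot u v) - l * homot u v + l * homot a t)) * cauchy_kern r w t)%C))
      by (intros; unfold rho; ring).
    rewrite CInt_minus by assumption.
    rewrite (CInt_ext (fun s => (rho s d - rho s c) * mu s)%C
      (fun s => ((pull s d - pull s c) * mu s -
        ((f (homot u v) - l * homot u v + l * homot s d) -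
         (f (homot u v) - l * homot u v + l * homot s c)) * mu s)%C))
      by (intros; unfold rho; ring).
    rewrite CInt_minus by assumption. ring. }
  rewrite Hsum.
  set (h := (b - a) + (d - c)).
  assert (Hh : 0 <= h) by (unfold h; lra).
  assert (Hr2 : cont2 rho).
  { destruct pull_cont as [P1 P2].
    split; intros x; apply ccont_minus.
    - apply P1.
    - apply ccont_plus; [apply ccont_const|].
      apply ccont_mult; [apply ccont_const|apply homot_cont1].
    - apply P2.
    - apply ccont_plus; [apply ccont_const|].
      apply ccont_mult; [apply ccont_const|apply homot_cont2]. }
  eapply Rle_trans.
  { apply (flux_bound rho a b c d (eps / K * (2 * r * h)) M Hr2); try lra.
    - apply Rmult_le_pos; [apply Rlt_le, Rdiv_lt_0_compat; lra|nra].
    - intros s t Hs Ht.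
      assert (Hdist : Cmod (homot s t - homot u v) <= 2 * r * h).
      { eapply Rle_trans; [apply homot_lipschitz|]. apply Rmult_le_compat_l; [lra|].
        assert (Rabs (s - u) <= b - a) by (apply Rabs_le; lra).
        assert (Rabs (t - v) <= d - c) by (apply Rabs_le; lra). unfold h; lra. }
      replace (rho s t) with (f (homot s t) - f (homot u v) - l * (homot s t - homot u v))%C
        by (unfold rho, pull; ring).
      eapply Rle_trans; [apply H0|].
      + apply Rle_lt_trans with (1 := Hdist).
        assert (h < 2 * (d0 / (4 * r))) by (unfold h; lra).
        replace d0 with (2 * r * (2 * (d0 / (4 * r)))) by (field; lra).
        apply Rmult_lt_compat_l; lra.
      + apply Rmult_le_compat_l; [apply Rlt_le, Rdiv_lt_0_compat; lra|exact Hdist].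
    - intros s Hs. unfold mu, M. rewrite Cmod_R, Rabs_mult.
      replace (Rabs (-2)) with 2 by (rewrite Rabs_left; lra).
      apply Rmult_le_compat_l; [lra|].
      replace s with (u + (s - u)) by ring.
      eapply Rle_trans; [apply Rabs_triang|]. apply Rplus_le_compat_l, Rabs_le. lra. }
  fold B h. right. unfold K. field. split; [lra|]. nra.
Qed.

Lemma flux_zero a b c d : a <= b -> c <= d -> flux pull a b c d = 0.
Proof.
  apply (bisection_zero (flux pull)).
  - intros; apply flux_split1, pull_cont.
  - intros; apply flux_split2, pull_cont.
  - apply flux_local.
Qed.

(** The circle is shrunk to [w] without changing the integral.  The two sides
   [t = 0] and [t = 2 PI] of the parameter rectangle cancel, so the vanishing of the flux
   compares the integral over the circle with the one over a tiny copy of it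
   around [w], on which [f] is almost [f w]. *)
Lemma cauchy_formula :
  CInt (fun t => f (circle r t) * cauchy_kern r w t)%C 0 (2 * PI) = (f w * CInt (cauchy_kern r w) 0 (2 * PI))%C.
Proof.
  pose proof PI_RGT_0 as HPI. pose proof radius_pos as Hr.
  set (B := r / (r - Cmod w)).
  assert (HB : 0 < B) by (apply Rdiv_lt_0_compat; lra).
  apply Cminus_eq_0, Cmod_eq_0, Rle_antisym; [|apply Cmod_ge_0].
  apply le_epsilon. intros eps He. rewrite Rplus_0_l.
  assert (HK : 0 < 2 * PI * B) by nra.
  destruct (f_diff w) as [l Hl]; [lra|].
  destruct (cderiv_cont _ _ _ Hl (eps / (2 * PI * B))) as [d0 [Hd0 H0]].
  { apply Rdiv_lt_0_compat; lra. }
  (* Once the contraction factor is below [eta], the contracted circle lies in the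
     disc of radius [d0] about [w]; the [S] chosen next achieves this since [S ^ 2 >= S]. *)
  set (eta := d0 / (2 * r)).
  assert (Heta : 0 < eta) by (apply Rdiv_lt_0_compat; lra).
  set (S := 1 + Rabs (ln eta)).
  assert (HS : 1 <= S) by (pose proof (Rabs_pos (ln eta)); unfold S; lra).
  assert (HgS : shrink S < eta).
  { rewrite <- (exp_ln eta Heta). apply exp_increasing.
    pose proof (Rle_abs (- ln eta)). rewrite Rabs_Ropp in *.
    assert (S <= S * S) by nra. unfold S in *. lra. }
  destruct pull_cont as [P1 P2].
  assert (HJ := flux_zero 0 S 0 (2 * PI) ltac:(lra) ltac:(lra)).
  unfold flux in HJ.
  rewrite (CInt_ext (fun s => (pull s (2 * PI) - pull s 0) * mu s)%C (fun _ => RtoC 0 * RtoC 0)%C) in HJ.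
  2: { intros s. unfold pull, homot, circle, expi.
       rewrite cos_2PI, sin_2PI, cos_0, sin_0. ring. }
  rewrite CInt_scal in HJ by apply ccont_const.
  rewrite Cmult_0_l, Cmult_0_r, Cplus_0_r in HJ.
  assert (E0 : forall t, pull 0 t = f (circle r t)).
  { intros t. unfold pull, homot, shrink. rewrite Rmult_0_l, Ropp_0, exp_0.
    f_equal. ring. }
  assert (Hk := cauchy_kern_cont).
  rewrite (CInt_ext _ (fun t => pull S t * cauchy_kern r w t - f (circle r t) * cauchy_kern r w t)%C) in HJ
    by (intros; rewrite E0; ring).
  assert (Hc0 : ccont (fun t => f (circle r t) * cauchy_kern r w t)%C).
  { apply ccont_mult; [|exact Hk]. apply ccont_ext with (pull 0); [exact E0|apply P1]. }
  rewrite CInt_minus in HJ; [|apply ccont_mult; [apply P1|exact Hk]|exact Hc0].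
  apply Cminus_eq_0 in HJ. rewrite <- HJ.
  rewrite <- CInt_scal by exact Hk.
  rewrite <- CInt_minus; [|apply ccont_mult; [apply P1|exact Hk]|
     apply ccont_mult; [apply ccont_const|exact Hk]].
  eapply Rle_trans; [apply CInt_bound with (M := eps / (2 * PI * B) * B)|].
  - apply ccont_minus; apply ccont_mult; try exact Hk; [apply P1|apply ccont_const].
  - lra.
  - intros t _. replace (pull S t * cauchy_kern r w t - f w * cauchy_kern r w t)%C
      with ((pull S t - f w) * cauchy_kern r w t)%C by ring.
    rewrite Cmod_mult. apply Rmult_le_compat; try apply Cmod_ge_0; [|apply cauchy_kern_bound].
    apply Rlt_le, H0. unfold homot.
    replace (w + shrink S * (circle r t - w) - w)%C with (shrink S * (circle r t - w))%C by ring.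
    rewrite Cmod_mult, Cmod_R, Rabs_pos_eq by (pose proof (shrink_bounds S); lra).
    apply Rle_lt_trans with (shrink S * (2 * r)).
    + apply Rmult_le_compat_l; [pose proof (shrink_bounds S); lra|apply circle_w_upper].
    + replace d0 with (eta * (2 * r)) by (unfold eta; field; lra).
      apply Rmult_lt_compat_r; lra.
  - right. field. split; lra.
Qed.

End Cauchy.

Lemma RtoC_neq (x : R) : x <> 0 -> RtoC x <> 0.
Proof. intros H E. apply H. exact (RtoC_inj _ _ E). Qed.

Lemma circle_neq r t : 0 < r -> circle r t <> 0.
Proof.
  intros Hr. apply Cmod_gt_0. unfold circle.
  rewrite Cmod_mult, Cmod_expi, Cmod_R, Rabs_pos_eq; lra.
Qed.

(** On the circle the conjugate of the kernel is the restriction of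
   [1 / (1 - conj w z / r ^ 2)], which is holomorphic on the closed disc; its mean is
   its value at the centre, which is [1]. *)
Lemma cauchy_kern_integral r w : Cmod w < r ->
  CInt (cauchy_kern r w) 0 (2 * PI) = RtoC (2 * PI).
Proof.
  intros Hw. assert (Hr : 0 < r) by (apply Rle_lt_trans with (2 := Hw), Cmod_ge_0).
  (* On the circle [conj z = r ^ 2 / z], which turns the conjugate of the kernel into [F]. *)
  set (F := fun z => (/ (1 - Cconj w * / (RtoC r * RtoC r) * z))%C).
  assert (Hr0 : RtoC r <> 0) by (apply RtoC_neq; lra).
  assert (Hne : forall z, Cmod z <= r -> (1 - Cconj w * / (RtoC r * RtoC r) * z <> 0)%C).
  { intros z Hz. apply Cmod_gt_0.
    eapply Rlt_le_trans; [|apply Cmod_rev_triangle].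
    rewrite Cmod_1, !Cmod_mult, Cmod_conj, Cmod_inv, Cmod_mult, Cmod_R, Rabs_pos_eq.
    3: apply Cmult_neq_0; assumption.
    2: lra.
    assert (Cmod w * / (r * r) * Cmod z <= Cmod w * / (r * r) * r).
    { apply Rmult_le_compat_l; [|assumption].
      apply Rmult_le_pos; [apply Cmod_ge_0|].
      apply Rlt_le, Rinv_0_lt_compat; nra. }
    assert (Cmod w * / (r * r) * r = Cmod w / r) by (field; lra).
    assert (Cmod w / r < 1) by (apply Rlt_div_l; lra). lra. }
  assert (HF : forall z, Cmod z <= r -> exists l, cderiv F z l).
  { intros z Hz. eexists. unfold F.
    apply (cderiv_comp Cinv (fun z => 1 - Cconj w * / (RtoC r * RtoC r) * z)%C).
    - apply cderiv_inv, Hne, Hz.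
    - apply cderiv_minus; [apply cderiv_const|].
      apply cderiv_mult; [apply cderiv_const|apply cderiv_id]. }
  assert (Hk0 : forall t, cauchy_kern r 0 t = 1).
  { intros t. unfold cauchy_kern. replace (circle r t - 0)%C with (circle r t) by ring.
    field. apply circle_neq, Hr. }
  assert (HC := cauchy_formula F r 0 HF ltac:(rewrite Cmod_0; lra)).
  assert (Hone : CInt (cauchy_kern r 0) 0 (2 * PI) = RtoC (2 * PI)).
  { rewrite (CInt_ext _ (fun _ => RtoC 1)) by exact Hk0.
    rewrite (CInt_derive (fun t => RtoC t) _ _ _ (ccont_const _)).
    - rewrite <- RtoC_minus. f_equal; ring.
    - intros t; split; simpl; auto_derive; trivial. }
  rewrite Hone in HC.
  rewrite <- (Cconj_conj (CInt _ _ _)), <- CInt_conj by exact (cauchy_kern_cont r w Hw).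
  rewrite (CInt_ext _ (fun t => F (circle r t) * cauchy_kern r 0 t)%C).
  - rewrite HC. unfold F. rewrite Cmult_0_r.
    replace (1 - 0)%C with (RtoC 1) by ring.
    apply injective_projections; simpl; field.
  - intros t. rewrite Hk0. assert (Hz := circle_neq r t Hr).
    assert (Hg := circle_w_neq r w Hw t).
    assert (Hn := Hne (circle r t) ltac:(rewrite (Cmod_circle r w Hw); lra)).
    assert (Hj : (Cconj (circle r t) * circle r t = RtoC r * RtoC r)%C).
    { rewrite Cmult_comm, <- Cmod2_conj, (Cmod_circle r w Hw), <- RtoC_mult. f_equal. ring. }
    unfold F, cauchy_kern. clear HC Hone Hne HF F Hk0.
    set (z := circle r t) in *. clearbody z.
    rewrite Cdiv_conj by exact Hg. rewrite Cminus_conj.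
    assert (Hzc : Cconj z <> 0).
    { intro E. apply Hz. rewrite <- (Cconj_conj z), E. apply injective_projections; simpl; ring. }
    assert (Hgc : (Cconj z - Cconj w <> 0)%C).
    { rewrite <- Cminus_conj. intro E. apply Hg. rewrite <- (Cconj_conj (z - w)), E.
      apply injective_projections; simpl; ring. }
    rewrite <- Hj in *.
    field. repeat split; assumption.
Qed.

(** * Taylor expansions with remainder *)

Fixpoint taylor_poly (a : nat -> C) (n : nat) (w : C) : C :=
  match n with
  | O => 0
  | S m => (taylor_poly a m w + a m * w ^ m)%C
  end.

(** Only finite sums and an explicit remainder are used.  This makes limits of
   sequences of functions accessible one coefficient at a time. *)
Definition taylor (f : C -> C) (r M : R) (a : nat -> C) : Prop :=
  (forall k, Cmod (a k) <= M / r ^ k) /\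
  (forall n w, Cmod w < r ->
     Cmod (f w - taylor_poly a n w) <= M * (Cmod w / r) ^ n * (r / (r - Cmod w))).

(** The kernel [z / (z - w)] is a finite geometric sum in [w / z] plus the
   remainder [(w / z) ^ n (z / (z - w))]. *)
Lemma taylor_exists (f : C -> C) r M : 0 < r ->
  (forall z, Cmod z <= r -> exists l, cderiv f z l) ->
  (forall z, Cmod z <= r -> Cmod (f z) <= M) ->
  exists a, taylor f r M a.
Proof.
  intros Hr Hf HM. pose proof PI_RGT_0 as HPI.
  set (g := circle r).
  assert (Hgm : forall t, Cmod (g t) = r).
  { intros t. apply (Cmod_circle r 0). rewrite Cmod_0. exact Hr. }
  assert (Hg0 : forall t, g t <> 0) by (intros; apply circle_neq; assumption).
  assert (Hgc : ccont g) by (apply circle_cont).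
  assert (Hfg : ccont (fun t => f (g t))).
  { apply ccont_comp; [|exact Hgc]. intros; apply Hf. rewrite Hgm; lra. }
  assert (Hpow : forall k F, ccont F -> ccont (fun t => F t ^ k)%C).
  { intros k F HF. induction k; simpl; [apply ccont_const|].
    apply (ccont_mult F (fun t => F t ^ k)%C); assumption. }
  assert (Hinv : ccont (fun t => / g t)%C) by (apply ccont_inv; assumption).
  assert (HM0 : 0 <= M).
  { apply Rle_trans with (Cmod (f 0)); [apply Cmod_ge_0|]. apply HM. rewrite Cmod_0; lra. }
  exists (fun k => / RtoC (2 * PI) * CInt (fun t => f (g t) * (/ g t) ^ k) 0 (2 * PI))%C.
  assert (H2pi : RtoC (2 * PI) <> 0) by (apply RtoC_neq; lra).
  assert (Hmod2 : Cmod (/ RtoC (2 * PI)) = / (2 * PI)).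
  { rewrite Cmod_inv, Cmod_R, Rabs_pos_eq; trivial; lra. }
  split.
  - intros k. rewrite Cmod_mult, Hmod2.
    apply Rle_trans with (/ (2 * PI) * ((2 * PI - 0) * (M / r ^ k))).
    + apply Rmult_le_compat_l; [apply Rlt_le, Rinv_0_lt_compat; lra|].
      apply CInt_bound; [|lra|].
      { apply (ccont_mult (fun t => f (g t)) (fun t => (/ g t) ^ k)%C); [exact Hfg|].
        apply Hpow, Hinv. }
      intros t _. rewrite Cmod_mult, Cmod_pow, Cmod_inv, Hgm by apply Hg0.
      rewrite pow_inv. apply Rmult_le_compat_r.
      { apply Rlt_le, Rinv_0_lt_compat, pow_lt; assumption. }
      apply HM. rewrite Hgm; lra.
    + right. field. split; [apply pow_nonzero|]; lra.
  - intros n w Hw.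
    assert (HC := cauchy_formula f r w Hf Hw).
    rewrite cauchy_kern_integral in HC by exact Hw.
    assert (Hk := cauchy_kern_cont r w Hw). assert (Hkb := cauchy_kern_bound r w Hw).
    change (circle r) with g in HC. set (K := cauchy_kern r w) in *.
    assert (Hgw : forall t, (g t - w <> 0)%C) by exact (circle_w_neq r w Hw).
    set (a := fun k => (/ RtoC (2 * PI) * CInt (fun t => f (g t) * (/ g t) ^ k) 0 (2 * PI))%C).
    assert (Hrem : forall m, ccont (fun t => f (g t) * ((w / g t) ^ m * K t))%C).
    { intros m. apply (ccont_mult (fun t => f (g t))); [exact Hfg|].
      apply (ccont_mult (fun t => (w / g t) ^ m)%C); [|exact Hk].
      apply Hpow. apply (ccont_mult (fun _ => w)); [apply ccont_const|exact Hinv]. }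
    assert (Hn : (f w = taylor_poly a n w +
      / RtoC (2 * PI) * CInt (fun t => f (g t) * ((w / g t) ^ n * K t)) 0 (2 * PI))%C).
    { induction n as [|n IH].
      - simpl. rewrite (CInt_ext _ (fun t => f (g t) * K t)%C).
        + rewrite HC. field. exact H2pi.
        + intros t. simpl. ring.
      - rewrite IH. simpl taylor_poly. unfold a at 3.
        rewrite (CInt_ext _ (fun t => w ^ n * (f (g t) * (/ g t) ^ n) +
          f (g t) * ((w / g t) ^ S n * K t))%C).
        + rewrite CInt_plus, CInt_scal; [ring| | |apply Hrem].
          * apply (ccont_mult (fun t => f (g t)) (fun t => (/ g t) ^ n)%C); [exact Hfg|].
            apply Hpow, Hinv.
          * apply (ccont_mult (fun _ => w ^ n)%C); [apply ccont_const|].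
            apply (ccont_mult (fun t => f (g t)) (fun t => (/ g t) ^ n)%C); [exact Hfg|].
            apply Hpow, Hinv.
        + intros t. rewrite Cpow_S. unfold Cdiv. rewrite Cpow_mult_l.
          assert (E : K t = (1 + w / g t * K t)%C).
          { unfold K, cauchy_kern. change (circle r t) with (g t).
            field. split; [apply Hgw|apply Hg0]. }
          rewrite E at 1. unfold Cdiv. ring. }
    rewrite Hn at 1.
    replace (taylor_poly a n w + _ - taylor_poly a n w)%C with
     (/ RtoC (2 * PI) * CInt (fun t => f (g t) * ((w / g t) ^ n * K t)) 0 (2 * PI))%C by ring.
    rewrite Cmod_mult, Hmod2.
    apply Rle_trans with (/ (2 * PI) * ((2 * PI - 0) * (M * ((Cmod w / r) ^ n * (r / (r - Cmod w)))))).
    + apply Rmult_le_compat_l; [apply Rlt_le, Rinv_0_lt_compat; lra|].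
      apply CInt_bound; [apply Hrem|lra|].
      intros t _. rewrite !Cmod_mult, Cmod_pow, Cmod_div, Hgm by apply Hg0.
      apply Rmult_le_compat; try apply Cmod_ge_0.
      * apply Rmult_le_pos; [|apply Cmod_ge_0]. apply pow_le.
        apply Rmult_le_pos; [apply Cmod_ge_0|apply Rlt_le, Rinv_0_lt_compat; lra].
      * apply HM. rewrite Hgm; lra.
      * apply Rmult_le_compat_l; [|apply Hkb]. apply pow_le.
        apply Rmult_le_pos; [apply Cmod_ge_0|apply Rlt_le, Rinv_0_lt_compat; lra].
    + right. field. split; lra.
Qed.

Lemma taylor_M_pos f r M a : taylor f r M a -> 0 <= M.
Proof.
  intros [H _]. specialize (H 0%nat). simpl in H.
  pose proof (Cmod_ge_0 (a 0%nat)). lra.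
Qed.

Lemma taylor_at (f : C -> C) z0 r M : 0 < r ->
  (forall z, Cmod (z - z0) <= r -> exists l, cderiv f z l) ->
  (forall z, Cmod (z - z0) <= r -> Cmod (f z) <= M) ->
  exists a, taylor (fun w => f (z0 + w)%C) r M a.
Proof.
  intros Hr Hf HM. apply taylor_exists; [exact Hr| |].
  - intros z Hz. destruct (Hf (z0 + z)%C) as [l Hl].
    { replace (z0 + z - z0)%C with z by ring. exact Hz. }
    eexists. eapply (cderiv_comp f (fun w => z0 + w)%C); [exact Hl|].
    apply cderiv_plus; [apply cderiv_const|apply cderiv_id].
  - intros z Hz. apply HM. replace (z0 + z - z0)%C with z by ring. exact Hz.
Qed.

Lemma taylor_half f r M a : 0 < r -> taylor f r M a ->
  forall n w, Cmod w <= r / 2 -> Cmod (f w - taylor_poly a n w) <= 2 * M * (Cmod w / r) ^ n.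
Proof.
  intros Hr HT n w Hw. assert (HM := taylor_M_pos _ _ _ _ HT).
  destruct HT as [_ H].
  eapply Rle_trans; [apply H; lra|].
  assert (0 <= (Cmod w / r) ^ n).
  { apply pow_le, Rmult_le_pos; [apply Cmod_ge_0|apply Rlt_le, Rinv_0_lt_compat; lra]. }
  assert (r / (r - Cmod w) <= 2) by (apply Rle_div_l; lra).
  assert (0 <= M * (Cmod w / r) ^ n) by (apply Rmult_le_pos; assumption).
  replace (2 * M * (Cmod w / r) ^ n) with (M * (Cmod w / r) ^ n * 2) by ring.
  apply Rmult_le_compat_l; assumption.
Qed.

(** The coefficient of order [m] is controlled by a single value of [f] once the lower
   coefficients are.  Inductions on the order rest on this. *)
Lemma coef_bound f r M a m t : 0 < r -> taylor f r M a -> 0 < t <= r / 2 ->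
  Cmod (a m) * t ^ m <=
    Cmod (f (RtoC t)) + Cmod (taylor_poly a m (RtoC t)) + 2 * M * (t / r) ^ S m.
Proof.
  intros Hr HT Ht.
  assert (H := taylor_half f r M a Hr HT (S m) (RtoC t)).
  rewrite Cmod_R, Rabs_pos_eq in H by lra. specialize (H ltac:(lra)).
  replace (Cmod (a m) * t ^ m) with (Cmod (a m * RtoC t ^ m)).
  2: { rewrite Cmod_mult, Cmod_pow, Cmod_R, Rabs_pos_eq by lra. reflexivity. }
  replace (a m * RtoC t ^ m)%C with
    (f (RtoC t) - taylor_poly a m (RtoC t) - (f (RtoC t) - taylor_poly a (S m) (RtoC t)))%C
    by (simpl; ring).
  eapply Rle_trans; [apply Cmod_minus_le|].
  pose proof (Cmod_minus_le (f (RtoC t)) (taylor_poly a m (RtoC t))). lra.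
Qed.

Lemma taylor_poly_zero (a : nat -> C) m w : (forall k, (k < m)%nat -> a k = 0) -> taylor_poly a m w = 0.
Proof.
  induction m as [|m IH]; intros H; simpl; [reflexivity|].
  rewrite IH by (intros; apply H; lia). rewrite H by lia. ring.
Qed.

Lemma small_le_zero x K : (exists d, 0 < d /\ forall t, 0 < t < d -> x <= K * t) -> x <= 0.
Proof.
  intros [d [Hd H]]. apply Rnot_lt_le. intros Hx.
  set (t := Rmin (d / 2) (x / (2 * (Rabs K + 1)))).
  pose proof (Rabs_pos K). pose proof (Rle_abs K).
  assert (H2 : 0 < x / (2 * (Rabs K + 1))) by (apply Rdiv_lt_0_compat; lra).
  assert (Ht : 0 < t) by (apply Rmin_glb_lt; lra).
  assert (Htd : t < d) by (pose proof (Rmin_l (d / 2) (x / (2 * (Rabs K + 1)))); unfold t; lra).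
  specialize (H t (conj Ht Htd)).
  assert (t <= x / (2 * (Rabs K + 1))) by apply Rmin_r.
  assert (t * (2 * (Rabs K + 1)) <= x).
  { apply Rle_div_r in H3; lra. }
  assert (K * t <= (Rabs K + 1) * t) by (apply Rmult_le_compat_r; lra). nra.
Qed.

Lemma taylor_vanish f r M (a : nat -> C) m K : 0 < r -> taylor f r M a ->
  (exists d, 0 < d /\ forall t, 0 < t < d -> Cmod (f (RtoC t)) <= K * t ^ m) ->
  forall k, (k < m)%nat -> a k = 0.
Proof.
  intros Hr HT [d [Hd H]]. assert (HM := taylor_M_pos _ _ _ _ HT).
  assert (HK : 0 <= K).
  { specialize (H (d / 2) ltac:(lra)). pose proof (Cmod_ge_0 (f (RtoC (d / 2)))).
    assert (0 < (d / 2) ^ m) by (apply pow_lt; lra). nra. }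
  intros k. induction k as [k IH] using (well_founded_induction Wf_nat.lt_wf).
  intros Hk. apply Cmod_eq_0. apply Rle_antisym; [|apply Cmod_ge_0].
  apply small_le_zero with (K + 2 * M * (/ r) ^ S k).
  exists (Rmin (Rmin d 1) (r / 2)). split.
  { repeat apply Rmin_glb_lt; lra. }
  intros t [Ht0 Ht].
  assert (Ht1 := Rlt_le_trans _ _ _ Ht (Rmin_l _ _)).
  assert (Ht2 := Rlt_le_trans _ _ _ Ht (Rmin_r _ _)).
  assert (Ht3 := Rlt_le_trans _ _ _ Ht1 (Rmin_l _ _)).
  assert (Ht4 := Rlt_le_trans _ _ _ Ht1 (Rmin_r _ _)).
  pose proof (coef_bound f r M a k t Hr HT ltac:(lra)) as Hc.
  rewrite (taylor_poly_zero a k), Cmod_0 in Hc by (intros; apply IH; lia).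
  specialize (H t ltac:(lra)).
  assert (Hp : 0 < t ^ k) by (apply pow_lt; assumption).
  apply Rmult_le_reg_r with (1 := Hp).
  eapply Rle_trans; [exact Hc|].
  assert (Hpow : t ^ m <= t * t ^ k).
  { replace m with ((m - S k) + S k)%nat by lia. rewrite pow_add. simpl.
    rewrite <- (Rmult_1_l (t * t ^ k)) at 2. apply Rmult_le_compat_r; [nra|].
    rewrite <- (pow1 (m - S k)). apply pow_incr. lra. }
  unfold Rdiv at 1. rewrite Rpow_mult_distr. simpl (t ^ S k).
  assert (K * t ^ m <= K * (t * t ^ k)) by (apply Rmult_le_compat_l; assumption).
  lra.
Qed.

(** A bounded function that vanishes to order [m] at the centre satisfies a Schwarz
   estimate of order [m], with a factor that does not depend on [m]. *)
Lemma taylor_order f r M a m K : 0 < r -> taylor f r M a ->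
  (exists d, 0 < d /\ forall t, 0 < t < d -> Cmod (f (RtoC t)) <= K * t ^ m) ->
  forall w, Cmod w < r -> Cmod (f w) <= M * (Cmod w / r) ^ m * (r / (r - Cmod w)).
Proof.
  intros Hr HT H w Hw. replace (f w) with (f w - taylor_poly a m w)%C.
  - apply HT. exact Hw.
  - rewrite (taylor_poly_zero a m); [ring|]. exact (taylor_vanish f r M a m K Hr HT H).
Qed.

Lemma taylor_coef0 f r M a : 0 < r -> taylor f r M a -> f 0 = a 0%nat.
Proof.
  intros Hr HT. assert (H := taylor_half f r M a Hr HT 1 0).
  rewrite Cmod_0 in H. specialize (H ltac:(lra)).
  replace (2 * M * (0 / r) ^ 1) with 0 in H by (field; lra).
  apply Cminus_eq_0, Cmod_eq_0, Rle_antisym; [|apply Cmod_ge_0].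
  eapply Rle_trans; [|exact H]. right. f_equal. simpl. ring.
Qed.

Lemma lipschitz_of_bound (f : C -> C) z0 r M : 0 < r ->
  (forall z, Cmod (z - z0) <= r -> exists l, cderiv f z l) ->
  (forall z, Cmod (z - z0) <= r -> Cmod (f z) <= M) ->
  forall z, Cmod (z - z0) < r ->
  Cmod (f z - f z0) <= M * Cmod (z - z0) / (r - Cmod (z - z0)).
Proof.
  intros Hr Hf HM z Hz. destruct (taylor_at f z0 r M Hr Hf HM) as [a HT].
  assert (E := taylor_coef0 _ _ _ _ Hr HT). simpl in E.
  destruct HT as [_ HT]. specialize (HT 1%nat (z - z0)%C Hz).
  simpl in HT. replace (z0 + (z - z0))%C with z in HT by ring.
  replace (z0 + 0)%C with z0 in E by ring.
  replace (f z - (0 + a 0%nat * 1))%C with (f z - f z0)%C in HT by (rewrite E; ring).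
  eapply Rle_trans; [exact HT|]. right. field. lra.
Qed.

Lemma pow_domination x y K : 0 <= x -> 0 <= y ->
  (forall n, x ^ n <= K * y ^ n) -> x <= y.
Proof.
  intros Hx Hy H. apply Rnot_lt_le. intros Hlt.
  destruct (Req_dec y 0) as [->|Hy0].
  - specialize (H 1%nat). simpl in H. lra.
  - assert (Hq : 1 < x / y) by (apply Rlt_div_r; lra).
    destruct (Pow_x_infinity (x / y)) with (b := K + 1) as [n Hn].
    { rewrite Rabs_pos_eq; lra. }
    specialize (Hn n (Nat.le_refl n)). specialize (H n).
    rewrite Rabs_pos_eq in Hn by (apply pow_le; lra).
    unfold Rdiv in Hn. rewrite Rpow_mult_distr, pow_inv in Hn.
    assert (Hp : 0 < y ^ n) by (apply pow_lt; lra).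
    assert (x ^ n * / y ^ n <= K); [|lra].
    apply Rle_div_l; lra.
Qed.

Lemma cderiv_pow f z n : (exists l, cderiv f z l) ->
  exists l, cderiv (fun v => f v ^ n)%C z l.
Proof.
  intros [l Hl]. induction n as [|n [m IH]]; simpl.
  - eexists; apply cderiv_const.
  - eexists. apply (cderiv_mult f (fun v => f v ^ n)%C); eassumption.
Qed.

Lemma cderiv_linear_bound f z l : cderiv f z l ->
  exists d, 0 < d /\ forall v, Cmod (v - z) < d ->
    Cmod (f v - f z) <= (1 + Cmod l) * Cmod (v - z).
Proof.
  intros H. destruct (proj1 (cderiv_eps f z l) H 1 Rlt_0_1) as [d [Hd Hv]].
  exists d; split; [exact Hd|]. intros v Hlt. specialize (Hv v Hlt).
  replace (f v - f z)%C with ((f v - f z - l * (v - z)) + l * (v - z))%C by ring.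
  eapply Rle_trans; [apply Cmod_triangle|]. rewrite Cmod_mult. lra.
Qed.

(** Apply [taylor_order] to [f ^ n], which vanishes to order [n], take
   [n]-th roots and let [n] tend to infinity: the factor [r / (r - |w|)] disappears. *)
Lemma schwarz (f : C -> C) :
  (forall z, Cmod z < 1 -> exists l, cderiv f z l) ->
  (forall z, Cmod z < 1 -> Cmod (f z) <= 1) -> f 0 = 0 ->
  forall w, Cmod w < 1 -> Cmod (f w) <= Cmod w.
Proof.
  intros Hf HM H0 w Hw. pose proof (Cmod_ge_0 w) as Hw0.
  assert (Hr : forall r, Cmod w < r < 1 -> Cmod (f w) <= Cmod w / r).
  { intros r Hr. apply pow_domination with (r / (r - Cmod w)).
    - apply Cmod_ge_0.
    - apply Rmult_le_pos; [lra|]. apply Rlt_le, Rinv_0_lt_compat; lra.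
    - intros n. rewrite <- Cmod_pow.
      destruct (taylor_exists (fun z => f z ^ n)%C r 1) as [a HT]; [lra| | |].
      + intros z Hz. apply cderiv_pow, Hf. lra.
      + intros z Hz. rewrite Cmod_pow, <- (pow1 n). apply pow_incr.
        split; [apply Cmod_ge_0|apply HM; lra].
      + destruct (Hf 0) as [l Hl]; [rewrite Cmod_0; lra|].
        destruct (cderiv_linear_bound _ _ _ Hl) as [d [Hd Hlb]].
        eapply Rle_trans;
          [apply (taylor_order (fun z => f z ^ n)%C r 1 a n ((1 + Cmod l) ^ n)); [lra|exact HT| |lra]|].
        * exists d. split; [exact Hd|]. intros t Ht.
          specialize (Hlb (RtoC t)). rewrite H0 in Hlb.
          replace (RtoC t - 0)%C with (RtoC t) in Hlb by ring.
          replace (f (RtoC t) - 0)%C with (f (RtoC t)) in Hlb by ring.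
          rewrite Cmod_R, Rabs_pos_eq in Hlb by lra.
          rewrite Cmod_pow, <- Rpow_mult_distr. apply pow_incr.
          split; [apply Cmod_ge_0|]. apply Hlb. lra.
        * right. ring. }
  apply le_epsilon. intros eps He.
  set (q := Cmod w / (Cmod w + eps)).
  destruct (Req_dec (Cmod w) 0) as [E|E].
  { apply Cmod_eq_0 in E. rewrite E, H0, Cmod_0. lra. }
  (* Any [r] between [q] and [1] gives the bound [|w| / r <= |w| + eps]. *)
  set (r := Rmax ((1 + Cmod w) / 2) q).
  assert (Hq : q < 1) by (apply Rlt_div_l; lra).
  assert (r < 1) by (apply Rmax_lub_lt; lra).
  assert ((1 + Cmod w) / 2 <= r) by apply Rmax_l.
  assert (q <= r) by apply Rmax_r.
  eapply Rle_trans; [apply (Hr r); lra|].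
  apply Rle_div_l; [lra|].
  assert (Cmod w = q * (Cmod w + eps)) by (unfold q; field; lra).
  rewrite H3 at 1. rewrite Rmult_comm. apply Rmult_le_compat_l; lra.
Qed.

(** * Bounded sequences of holomorphic functions *)

Definition tends0 (u : nat -> C) : Prop :=
  forall eps, 0 < eps -> exists N, forall n, (N <= n)%nat -> Cmod (u n) < eps.

Lemma tends0_const (c : C) : tends0 (fun _ => c) -> c = 0.
Proof.
  intros H. apply Cmod_eq_0, Rle_antisym; [|apply Cmod_ge_0].
  apply le_epsilon. intros eps He. destruct (H eps He) as [N HN].
  specialize (HN N (Nat.le_refl N)). lra.
Qed.

Lemma tends0_zero : tends0 (fun _ => 0).
Proof. intros eps He. exists 0%nat. intros. rewrite Cmod_0. exact He. Qed.

Lemma tends0_plus u v : tends0 u -> tends0 v -> tends0 (fun n => u n + v n)%C.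
Proof.
  intros Hu Hv eps He.
  destruct (Hu (eps / 2)) as [N1 H1]; [lra|]. destruct (Hv (eps / 2)) as [N2 H2]; [lra|].
  exists (max N1 N2). intros n Hn.
  specialize (H1 n ltac:(lia)). specialize (H2 n ltac:(lia)).
  eapply Rle_lt_trans; [apply Cmod_triangle|lra].
Qed.

Lemma tends0_le u v K : (forall n, Cmod (v n) <= K * Cmod (u n)) -> tends0 u -> tends0 v.
Proof.
  intros H Hu eps He. pose proof (Rle_abs K). pose proof (Rabs_pos K).
  destruct (Hu (eps / (Rabs K + 1))) as [N HN]; [apply Rdiv_lt_0_compat; lra|].
  exists N. intros n Hn. specialize (HN n Hn). specialize (H n).
  apply Rlt_div_r in HN; [|lra]. pose proof (Cmod_ge_0 (u n)).
  destruct (Req_dec (Cmod (u n)) 0) as [E|E].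
  - rewrite E in H. lra.
  - assert (K * Cmod (u n) <= Rabs K * Cmod (u n)) by (apply Rmult_le_compat_r; lra). nra.
Qed.

Lemma tends0_scal c u : tends0 u -> tends0 (fun n => u n * c)%C.
Proof.
  apply tends0_le with (K := Cmod c). intros n. rewrite Cmod_mult. lra.
Qed.

Lemma tends0_taylor_poly (a : nat -> nat -> C) m w :
  (forall k, (k < m)%nat -> tends0 (fun n => a n k)) -> tends0 (fun n => taylor_poly (a n) m w).
Proof.
  induction m as [|m IH]; intros H; simpl; [apply tends0_zero|].
  apply tends0_plus; [apply IH; intros; apply H; lia|].
  apply tends0_scal, H. lia.
Qed.

(** The remainder is uniform in [n], so at a small enough fixed [t] the term of
   order [m] dominates the remainder, and the lower terms are already known to tend to [0]. *)
Lemma coefs_tends0 (S : nat -> C -> C) r M a d : 0 < r -> 0 < d ->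
  (forall n, taylor (S n) r M (a n)) ->
  (forall t, 0 < t < d -> tends0 (fun n => S n (RtoC t))) ->
  forall k, tends0 (fun n => a n k).
Proof.
  intros Hr Hd HT HS m.
  induction m as [m IH] using (well_founded_induction Wf_nat.lt_wf).
  assert (HM := taylor_M_pos _ _ _ _ (HT 0%nat)).
  intros eps He.
  set (K := 2 * M * (/ r) ^ Datatypes.S m).
  assert (HK : 0 <= K).
  { apply Rmult_le_pos; [lra|]. apply pow_le, Rlt_le, Rinv_0_lt_compat, Hr. }
  set (t := Rmin (Rmin (d / 2) (r / 2)) (eps / (2 * (K + 1)))).
  assert (H1 : 0 < eps / (2 * (K + 1))) by (apply Rdiv_lt_0_compat; lra).
  assert (Ht0 : 0 < t) by (repeat apply Rmin_glb_lt; lra).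
  assert (Ht1 : t <= Rmin (d / 2) (r / 2)) by apply Rmin_l.
  assert (Ht2 : t <= d / 2) by (eapply Rle_trans; [exact Ht1|apply Rmin_l]).
  assert (Ht3 : t <= r / 2) by (eapply Rle_trans; [exact Ht1|apply Rmin_r]).
  assert (Ht4 : t <= eps / (2 * (K + 1))) by apply Rmin_r.
  assert (Hp : 0 < t ^ m) by (apply pow_lt, Ht0).
  destruct (HS t ltac:(lra) (eps * t ^ m / 4)) as [N1 HN1]; [nra|].
  destruct (tends0_taylor_poly a m (RtoC t)) with (eps := eps * t ^ m / 4) as [N2 HN2];
    [intros; apply IH; assumption|nra|].
  exists (max N1 N2). intros n Hn.
  specialize (HN1 n ltac:(lia)). specialize (HN2 n ltac:(lia)).
  pose proof (coef_bound (S n) r M (a n) m t Hr (HT n) ltac:(lra)) as Hc.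
  apply Rmult_lt_reg_r with (1 := Hp).
  apply Rle_lt_trans with (1 := Hc).
  unfold Rdiv at 1. rewrite Rpow_mult_distr.
  replace (2 * M * (t ^ Datatypes.S m * (/ r) ^ Datatypes.S m)) with (K * t * t ^ m)
    by (unfold K; simpl; ring).
  assert (K * t <= eps / 2).
  { apply Rle_trans with ((K + 1) * t); [apply Rmult_le_compat_r; lra|].
    apply Rle_div_r in Ht4; lra. }
  assert (K * t * t ^ m <= eps / 2 * t ^ m) by (apply Rmult_le_compat_r; lra).
  lra.
Qed.

Lemma tends0_of_coefs (S : nat -> C -> C) r M a : 0 < r ->
  (forall n, taylor (S n) r M (a n)) -> (forall k, tends0 (fun n => a n k)) ->
  forall w, Cmod w < r -> tends0 (fun n => S n w).
Proof.
  intros Hr HT Ha w Hw eps He.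
  assert (HM := taylor_M_pos _ _ _ _ (HT 0%nat)). pose proof (Cmod_ge_0 w) as Hw0.
  assert (HB : 0 < r / (r - Cmod w)) by (apply Rdiv_lt_0_compat; lra).
  set (B := (M + 1) * (r / (r - Cmod w))).
  assert (HB' : 0 < B) by (apply Rmult_lt_0_compat; lra).
  assert (Hq0 : 0 <= Cmod w / r) by (apply Rmult_le_pos; [lra|apply Rlt_le, Rinv_0_lt_compat; lra]).
  destruct (pow_lt_1_zero (Cmod w / r)) with (y := eps / (2 * B)) as [m Hm].
  { rewrite Rabs_pos_eq; [|exact Hq0]. apply Rlt_div_l; lra. }
  { apply Rdiv_lt_0_compat; lra. }
  specialize (Hm m (Nat.le_refl m)).
  rewrite Rabs_pos_eq in Hm by (apply pow_le; lra).
  destruct (tends0_taylor_poly a m w) with (eps := eps / 2) as [N HN]; [intros; apply Ha|lra|].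
  exists N. intros n Hn. specialize (HN n Hn).
  replace (S n w) with ((S n w - taylor_poly (a n) m w) + taylor_poly (a n) m w)%C by ring.
  eapply Rle_lt_trans; [apply Cmod_triangle|].
  assert (Hrem : Cmod (S n w - taylor_poly (a n) m w) <= eps / 2); [|lra].
  eapply Rle_trans; [apply (HT n); exact Hw|].
  apply Rle_trans with ((Cmod w / r) ^ m * B).
  - assert (0 <= (Cmod w / r) ^ m) by (apply pow_le; lra). unfold B.
    assert (0 <= (Cmod w / r) ^ m * (r / (r - Cmod w))) by (apply Rmult_le_pos; lra). nra.
  - apply Rlt_le in Hm. apply Rle_div_r in Hm; lra.
Qed.

(** Convergence near the centre kills every Taylor coefficient in the limit, and the
   coefficients determine the functions on the whole disc. *)
Lemma vitali_ball (S : nat -> C -> C) z0 R M rho : 0 < rho ->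
  (forall n z, Cmod (z - z0) < R -> exists l, cderiv (S n) z l) ->
  (forall n z, Cmod (z - z0) < R -> Cmod (S n z) <= M) ->
  (forall z, Cmod (z - z0) < rho -> tends0 (fun n => S n z)) ->
  forall z, Cmod (z - z0) < R -> tends0 (fun n => S n z).
Proof.
  intros Hrho Hd HM Hc z Hz. pose proof (Cmod_ge_0 (z - z0)).
  set (r := (Cmod (z - z0) + R) / 2).
  assert (Hr : 0 < r) by (unfold r; lra).
  assert (HT : forall n, exists a, taylor (fun w => S n (z0 + w)%C) r M a).
  { intros n. apply taylor_at; [exact Hr| |]; intros v Hv; [apply Hd|apply HM];
     unfold r in *; lra. }
  pose (a := fun n => proj1_sig (constructive_indefinite_description _ (HT n))).
  assert (Ha : forall n, taylor (fun w => S n (z0 + w)%C) r M (a n)).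
  { intros n. exact (proj2_sig (constructive_indefinite_description _ (HT n))). }
  replace z with (z0 + (z - z0))%C by ring.
  apply (tends0_of_coefs (fun n w => S n (z0 + w)%C) r M a Hr Ha).
  - apply (coefs_tends0 (fun n w => S n (z0 + w)%C) r M a rho Hr Hrho Ha).
    intros t Ht. apply Hc. replace (z0 + RtoC t - z0)%C with (RtoC t) by ring.
    rewrite Cmod_R, Rabs_pos_eq; lra.
  - unfold r; lra.
Qed.

(** By [vitali_ball] the set of points near which the sequence tends to [0] is
   relatively closed in [D]. *)
Lemma vitali (D : C -> Prop) (S : nat -> C -> C) M z0 rho :
  open D -> connected_set D ->
  (forall n z, D z -> exists l, cderiv (S n) z l) ->
  (forall n z, D z -> Cmod (S n z) <= M) ->
  D z0 -> 0 < rho ->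
  (forall z, Cmod (z - z0) < rho -> tends0 (fun n => S n z)) ->
  forall z, D z -> tends0 (fun n => S n z).
Proof.
  intros HO HC Hd HM Hz0 Hrho Hc z Hz.
  set (U := fun v => exists e, 0 < e /\ forall u, Cmod (u - v) < e -> tends0 (fun n => S n u)).
  assert (HUz : U z).
  { apply NNPP. intros HnU.
    destruct (HC U (fun v => D v /\ ~ U v)) as [v [_ [HUv [_ HnUv]]]].
    - apply Cmod_open. intros v [e [He Hv]]. exists (e / 2). split; [lra|].
      intros u Hu. exists (e / 2). split; [lra|]. intros x Hx. apply Hv.
      replace (x - v)%C with ((x - u) + (u - v))%C by ring.
      eapply Rle_lt_trans; [apply Cmod_triangle|lra].
    - apply Cmod_open. intros v [HDv HnUv].
      destruct (open_Cmod D v HO HDv) as [e [He Hb]].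
      (* The disc of radius [2 e / 3] about such a [u] lies in [D] and contains the disc of
         radius [e / 3] about [v]. *)
      exists (e / 3). split; [lra|]. intros u Hu. split; [apply Hb; lra|].
      intros [s [Hs Hus]]. apply HnUv. exists (e / 3). split; [lra|].
      assert (Hin : forall x, Cmod (x - u) < 2 * e / 3 -> D x).
      { intros x Hx. apply Hb. replace (x - v)%C with ((x - u) + (u - v))%C by ring.
        eapply Rle_lt_trans; [apply Cmod_triangle|lra]. }
      intros x Hx. apply (vitali_ball S u (2 * e / 3) M s Hs).
      + intros; apply Hd, Hin; assumption.
      + intros; apply HM, Hin; assumption.
      + exact Hus.
      + replace (x - u)%C with ((x - v) + - (u - v))%C by ring.
        eapply Rle_lt_trans; [apply Cmod_triangle|]. rewrite Cmod_opp. lra.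
    - intros v Hv. destruct (classic (U v)); [left|right]; tauto.
    - exists z0. split; [exact Hz0|]. now exists rho.
    - exists z. tauto.
    - contradiction. }
  destruct HUz as [e [He Hu]]. apply Hu.
  replace (z - z)%C with (RtoC 0) by ring. rewrite Cmod_0. exact He.
Qed.

(** This is the Vitali theorem for a constant sequence. *)
Lemma identity_theorem (D : C -> Prop) (S : C -> C) M z0 rho :
  open D -> connected_set D ->
  (forall z, D z -> exists l, cderiv S z l) ->
  (forall z, D z -> Cmod (S z) <= M) ->
  D z0 -> 0 < rho -> (forall z, Cmod (z - z0) < rho -> S z = 0) ->
  forall z, D z -> S z = 0.
Proof.
  intros HO HC Hd HM Hz0 Hrho H0 z Hz.
  assert (Ht : tends0 (fun _ => S z)).
  { apply (vitali D (fun _ => S) M z0 rho); try assumption; try (intros; auto; fail).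
    intros v Hv. rewrite (H0 v Hv). apply tends0_zero. }
  exact (tends0_const _ Ht).
Qed.

(** * Iterates near a fixed point *)

(** The displacement [g (z0 + t) - z0] is asymptotic to [l t], hence its powers to those of [l t]. *)
Lemma ratio_limit (g : C -> C) z0 l m eta : cderiv g z0 l -> g z0 = z0 -> 0 < eta ->
  exists d, 0 < d /\ forall t, 0 < t < d ->
    Cmod (g (z0 + RtoC t)%C - z0) <= (1 + Cmod l) * t /\
    Cmod ((g (z0 + RtoC t)%C - z0) ^ m - (l * RtoC t) ^ m) <= eta * t ^ m.
Proof.
  intros Hg Hz He.
  destruct (cderiv_pow (fun v => v) l m) as [k Hk]; [eexists; apply cderiv_id|].
  destruct (cderiv_cont _ _ _ Hk eta He) as [d1 [Hd1 H1]].
  destruct (proj1 (cderiv_eps _ _ _) Hg (d1 / 2)) as [d2 [Hd2 H2]]; [lra|].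
  destruct (cderiv_linear_bound _ _ _ Hg) as [d3 [Hd3 H3]].
  exists (Rmin d2 d3). split; [apply Rmin_glb_lt; assumption|].
  intros t [Ht0 Ht].
  assert (Ht2 := Rlt_le_trans _ _ _ Ht (Rmin_l _ _)).
  assert (Ht3 := Rlt_le_trans _ _ _ Ht (Rmin_r _ _)).
  assert (Hd : (z0 + RtoC t - z0)%C = RtoC t) by ring.
  specialize (H2 (z0 + RtoC t)%C). specialize (H3 (z0 + RtoC t)%C).
  rewrite Hz, Hd, Cmod_R, Rabs_pos_eq in H2, H3 by lra.
  specialize (H2 Ht2). specialize (H3 Ht3). split; [exact H3|].
  set (W := (g (z0 + RtoC t) - z0)%C) in *.
  assert (Ht0' : RtoC t <> 0) by (apply RtoC_neq; lra).
  replace W with ((W / RtoC t) * RtoC t)%C by (field; assumption).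
  rewrite !Cpow_mult_l.
  replace ((W / RtoC t) ^ m * RtoC t ^ m - l ^ m * RtoC t ^ m)%C with
    (((W / RtoC t) ^ m - l ^ m) * RtoC t ^ m)%C by ring.
  rewrite Cmod_mult, Cmod_pow, Cmod_R, Rabs_pos_eq by lra.
  apply Rmult_le_compat_r; [apply pow_le; lra|]. apply Rlt_le, H1.
  replace (W / RtoC t - l)%C with ((W - l * RtoC t) / RtoC t)%C by (field; assumption).
  rewrite Cmod_div, Cmod_R, Rabs_pos_eq by (assumption || lra).
  apply Rle_lt_trans with (d1 / 2); [|lra]. apply Rle_div_l; lra.
Qed.

(** Composition with [g] multiplies the leading term of order [m] by
   [l ^ m].  If the lower coefficients are negligible, [S n (g z) - S n z] is close to
   [(l ^ m - 1) a_m (z - z0) ^ m], and since it tends to [0] while [l ^ m <> 1], so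
   does [a_m].  The rate may depend on [m], so that small divisors do no harm. *)
Lemma almost_invariant_coefs_tends0 (S : nat -> C -> C) (g : C -> C) z0 l r M a d :
  0 < r -> 0 < d -> (forall n, taylor (fun w => S n (z0 + w)%C) r M (a n)) ->
  cderiv g z0 l -> g z0 = z0 -> (forall m, (0 < m)%nat -> (l ^ m)%C <> 1) ->
  (forall n, S n z0 = 0) ->
  (forall z, Cmod (z - z0) < d -> tends0 (fun n => S n (g z) - S n z)%C) ->
  forall k, tends0 (fun n => a n k).
Proof.
  intros Hr Hd HT Hg Hz Hl HS0 HS m.
  induction m as [m IH] using (well_founded_induction Wf_nat.lt_wf).
  assert (HM := taylor_M_pos _ _ _ _ (HT 0%nat)).
  destruct m as [|m'].
  { apply tends0_le with (2 := tends0_zero) (K := 0). intros n.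
    rewrite <- (taylor_coef0 _ _ _ _ Hr (HT n)), Cplus_0_r, HS0, Cmod_0. lra. }
  set (m := Datatypes.S m') in *.
  set (c := Cmod (l ^ m - 1)).
  assert (Hc : 0 < c).
  { apply Cmod_gt_0. intro E. apply (Hl m); [unfold m; lia|]. apply Cminus_eq_0, E. }
  set (L := 1 + Cmod l). pose proof (Cmod_ge_0 l) as Hl0.
  destruct (ratio_limit g z0 l m (c / 2) Hg Hz) as [d1 [Hd1 H1]]; [lra|].
  intros eps He.
  (* The remainders at [t] and at its image, which has modulus at most [L t], together
     are at most [K t ^ (m + 1)].  The point [t] makes this small against [c t ^ m]. *)
  set (K := 2 * M * (L ^ Datatypes.S m + 1) * (/ r) ^ Datatypes.S m).
  assert (HL1 : 0 <= L ^ Datatypes.S m) by (apply pow_le; unfold L; lra).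
  assert (HK : 0 <= K).
  { apply Rmult_le_pos; [apply Rmult_le_pos; lra|]. apply pow_le, Rlt_le, Rinv_0_lt_compat, Hr. }
  set (t := Rmin (Rmin (d / 2) (r / (2 * L))) (Rmin (d1 / 2) (eps * c / (8 * (K + 1))))).
  assert (HL : 1 <= L) by (unfold L; lra).
  assert (Hq1 : 0 < r / (2 * L)) by (apply Rdiv_lt_0_compat; lra).
  assert (Hq2 : 0 < eps * c / (8 * (K + 1))).
  { apply Rdiv_lt_0_compat; [apply Rmult_lt_0_compat; lra|lra]. }
  assert (Ht0 : 0 < t) by (repeat apply Rmin_glb_lt; lra).
  assert (Ha1 : t <= Rmin (d / 2) (r / (2 * L))) by apply Rmin_l.
  assert (Ha2 : t <= Rmin (d1 / 2) (eps * c / (8 * (K + 1)))) by apply Rmin_r.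
  assert (Ht1 : t <= d / 2) by (eapply Rle_trans; [exact Ha1|apply Rmin_l]).
  assert (Ht2 : t <= r / (2 * L)) by (eapply Rle_trans; [exact Ha1|apply Rmin_r]).
  assert (Ht3 : t <= d1 / 2) by (eapply Rle_trans; [exact Ha2|apply Rmin_l]).
  assert (Ht4 : t <= eps * c / (8 * (K + 1))) by (eapply Rle_trans; [exact Ha2|apply Rmin_r]).
  clear Ha1 Ha2. clearbody t.
  assert (HLt : L * t <= r / 2).
  { apply Rle_trans with (L * (r / (2 * L))); [apply Rmult_le_compat_l; lra|].
    right. field. lra. }
  assert (Htr : t <= r / 2) by nra.
  destruct (H1 t ltac:(lra)) as [HW1 HW2]. clear H1.
  set (W := (g (z0 + RtoC t) - z0)%C) in *. fold L in HW1.
  assert (Hp : 0 < t ^ m) by (apply pow_lt, Ht0).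
  assert (Hec : 0 < eps * c * t ^ m / 16).
  { apply Rdiv_lt_0_compat; [|lra]. apply Rmult_lt_0_compat; [apply Rmult_lt_0_compat|]; assumption. }
  destruct (HS (z0 + RtoC t)%C) with (eps := eps * c * t ^ m / 16) as [N1 HN1].
  { replace (z0 + RtoC t - z0)%C with (RtoC t) by ring. rewrite Cmod_R, Rabs_pos_eq; lra. }
  { exact Hec. }
  destruct (tends0_taylor_poly a m (RtoC t)) with (eps := eps * c * t ^ m / 16) as [N2 HN2];
    [intros; apply IH; assumption|exact Hec|].
  destruct (tends0_taylor_poly a m W) with (eps := eps * c * t ^ m / 16) as [N3 HN3];
    [intros; apply IH; assumption|exact Hec|].
  exists (N1 + N2 + N3)%nat. intros n Hn.
  specialize (HN1 n ltac:(lia)). specialize (HN2 n ltac:(lia)). specialize (HN3 n ltac:(lia)).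
  assert (HR : forall v, Cmod v <= L * t ->
    Cmod (S n (z0 + v)%C - taylor_poly (a n) (Datatypes.S m) v) <=
      2 * M * (Cmod v / r) ^ Datatypes.S m).
  { intros v Hv. apply (taylor_half (fun w => S n (z0 + w)%C) r M); [exact Hr|apply HT|lra]. }
  assert (HRt := HR (RtoC t)). assert (HRW := HR W HW1). clear HR.
  rewrite Cmod_R, Rabs_pos_eq in HRt by lra. specialize (HRt ltac:(nra)).
  replace (z0 + W)%C with (g (z0 + RtoC t)%C) in HRW by (unfold W; ring).
  cbn [taylor_poly] in HRt, HRW.
  set (SW := S n (g (z0 + RtoC t)%C)) in *. set (St := S n (z0 + RtoC t)%C) in *.
  set (pW := taylor_poly (a n) m W) in *. set (pt := taylor_poly (a n) m (RtoC t)) in *.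
  assert (Hmain : Cmod (a n m * (W ^ m - RtoC t ^ m)) <=
     Cmod (SW - St) + Cmod pt + Cmod pW +
     (2 * M * (Cmod W / r) ^ Datatypes.S m + 2 * M * (t / r) ^ Datatypes.S m)).
  { replace (a n m * (W ^ m - RtoC t ^ m))%C with
      ((SW - St) + pt - pW - ((SW - (pW + a n m * W ^ m)) - (St - (pt + a n m * RtoC t ^ m))))%C
      by ring.
    eapply Rle_trans; [apply Cmod_minus_le|].
    pose proof (Cmod_minus_le ((SW - St) + pt)%C pW).
    pose proof (Cmod_triangle (SW - St)%C pt).
    pose proof (Cmod_minus_le (SW - (pW + a n m * W ^ m))%C (St - (pt + a n m * RtoC t ^ m))%C).
    lra. }
  rewrite Cmod_mult in Hmain.
  assert (Hlow : c / 2 * t ^ m <= Cmod (W ^ m - RtoC t ^ m)).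
  { replace (W ^ m - RtoC t ^ m)%C with
      ((l ^ m - 1) * RtoC t ^ m - (- (W ^ m - (l * RtoC t) ^ m)))%C
      by (rewrite Cpow_mult_l; ring).
    eapply Rle_trans; [|apply Cmod_rev_triangle].
    rewrite Cmod_opp, Cmod_mult, Cmod_pow, Cmod_R, Rabs_pos_eq by lra. fold c. lra. }
  assert (HWp : (Cmod W / r) ^ Datatypes.S m <= L ^ Datatypes.S m * (t / r) ^ Datatypes.S m).
  { rewrite <- Rpow_mult_distr. apply pow_incr. split.
    - apply Rmult_le_pos; [apply Cmod_ge_0|apply Rlt_le, Rinv_0_lt_compat, Hr].
    - unfold Rdiv. rewrite <- Rmult_assoc. apply Rmult_le_compat_r; [|exact HW1].
      apply Rlt_le, Rinv_0_lt_compat, Hr. }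
  assert (HKt : 2 * M * (Cmod W / r) ^ Datatypes.S m + 2 * M * (t / r) ^ Datatypes.S m
     <= K * t * t ^ m).
  { replace (K * t * t ^ m) with
      (2 * M * (L ^ Datatypes.S m * (t / r) ^ Datatypes.S m) + 2 * M * (t / r) ^ Datatypes.S m).
    - apply Rplus_le_compat_r. apply Rmult_le_compat_l; lra.
    - unfold K, Rdiv. rewrite !Rpow_mult_distr. simpl. ring. }
  assert (HKe : K * t <= eps * c / 8).
  { apply Rle_trans with ((K + 1) * t); [apply Rmult_le_compat_r; lra|].
    apply Rle_div_r in Ht4; lra. }
  assert (HKe' : K * t * t ^ m <= eps * c / 8 * t ^ m) by (apply Rmult_le_compat_r; lra).
  assert (Hfin : Cmod (a n m) * (c / 2 * t ^ m) <= Cmod (a n m) * Cmod (W ^ m - RtoC t ^ m)).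
  { apply Rmult_le_compat_l; [apply Cmod_ge_0|exact Hlow]. }
  assert (0 < c / 2 * t ^ m) by (apply Rmult_lt_0_compat; lra).
  apply Rmult_lt_reg_r with (c / 2 * t ^ m); [assumption|]. lra.
Qed.

Fixpoint csum (u : nat -> C) (n : nat) : C :=
  match n with
  | O => 0
  | S m => (csum u m + u m)%C
  end.

Lemma csum_bound u n M : (forall j, (j < n)%nat -> Cmod (u j) <= M) ->
  Cmod (csum u n) <= INR n * M.
Proof.
  induction n as [|n IH]; intros H; [simpl; rewrite Cmod_0; lra|].
  rewrite S_INR. cbn [csum]. eapply Rle_trans; [apply Cmod_triangle|].
  specialize (IH (fun j Hj => H j ltac:(lia))). specialize (H n ltac:(lia)). lra.
Qed.

Lemma csum_telescope (u : nat -> C) n :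
  csum (fun j => u (S j) - u j)%C n = (u n - u 0%nat)%C.
Proof. induction n as [|n IH]; cbn [csum]; [ring|rewrite IH; ring]. Qed.

Lemma csum_minus u v n : csum (fun j => u j - v j)%C n = (csum u n - csum v n)%C.
Proof. induction n as [|n IH]; cbn [csum]; [ring|rewrite IH; ring]. Qed.

Lemma csum_ext u v n : (forall j, (j < n)%nat -> u j = v j) -> csum u n = csum v n.
Proof.
  induction n as [|n IH]; intros H; cbn [csum]; [reflexivity|].
  rewrite (H n), IH; [reflexivity|intros; apply H; lia|lia].
Qed.

Lemma csum_cderiv (u : nat -> C -> C) z n :
  (forall j, exists l, cderiv (u j) z l) -> exists l, cderiv (fun v => csum (fun j => u j v) n) z l.
Proof.
  intros H. induction n as [|n [l Hl]]; cbn [csum].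
  - eexists; apply cderiv_const.
  - destruct (H n) as [k Hk]. eexists. eapply cderiv_plus; eassumption.
Qed.

Section Iteration.

Variables (D : C -> Prop) (g : C -> C) (z0 l : C).
Hypothesis D_open : open D.
Hypothesis D_conn : connected_set D.
Hypothesis g_self : forall z, D z -> D (g z).
Hypothesis g_diff : forall z, D z -> exists k, cderiv g z k.
Hypothesis z0_in : D z0.
Hypothesis z0_fix : g z0 = z0.
Hypothesis g_mult : cderiv g z0 l.

Lemma iter_self n z : D z -> D (Nat.iter n g z).
Proof. induction n; simpl; auto. Qed.

Lemma iter_diff n z : D z -> exists k, cderiv (Nat.iter n g) z k.
Proof.
  intros Hz. induction n as [|n [k Hk]].
  - eexists. exact (cderiv_id z).
  - destruct (g_diff (Nat.iter n g z) (iter_self n z Hz)) as [m Hm].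
    eexists. exact (cderiv_comp g (Nat.iter n g) z m k Hm Hk).
Qed.

Lemma iter_fix n : Nat.iter n g z0 = z0.
Proof. induction n; simpl; [reflexivity|rewrite IHn; assumption]. Qed.

Lemma iter_mult n : cderiv (Nat.iter n g) z0 (l ^ n)%C.
Proof.
  induction n as [|n IH]; simpl.
  - exact (cderiv_id z0).
  - rewrite Cmult_comm. apply (cderiv_comp g (Nat.iter n g) z0 l (l ^ n)%C); [|exact IH].
    rewrite iter_fix. exact g_mult.
Qed.

Variable h : C -> C.
Hypothesis h_diff : forall z, D z -> exists k, cderiv h z k.
Hypothesis h_bound : forall z, D z -> Cmod (h z) <= 1.

Lemma h_iter_diff n z : D z -> exists k, cderiv (fun v => h (Nat.iter n g v)) z k.
Proof.
  intros Hz. destruct (iter_diff n z Hz) as [k Hk].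
  destruct (h_diff _ (iter_self n z Hz)) as [m Hm].
  eexists. exact (cderiv_comp h (Nat.iter n g) z m k Hm Hk).
Qed.

Lemma closed_ball : exists r, 0 < r /\ forall z, Cmod (z - z0) <= r -> D z.
Proof.
  destruct (open_Cmod D z0 D_open z0_in) as [r [Hr H]].
  exists (r / 2). split; [lra|]. intros z Hz. apply H. lra.
Qed.

Definition average (n : nat) (z : C) : C :=
  (csum (fun j => h (Nat.iter j g z)) (S n) / RtoC (INR (S n)))%C.

Lemma average_bound n z M : (forall j, Cmod (h (Nat.iter j g z)) <= M) ->
  Cmod (average n z) <= M.
Proof.
  intros H. unfold average.
  assert (Hn : 0 < INR (S n)) by (apply lt_0_INR; lia).
  rewrite Cmod_div, Cmod_R, Rabs_pos_eq by (try apply RtoC_neq; lra).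
  apply Rle_div_l; [exact Hn|].
  rewrite Rmult_comm. apply csum_bound. intros; apply H.
Qed.

(** Averages along orbits are almost invariant: replacing [z] by [g z] changes only the
   two end terms, which weigh [2 / (n + 1)]. *)
Lemma average_nonresonant : (forall m, (0 < m)%nat -> (l ^ m)%C <> 1) ->
  forall z, D z -> tends0 (fun n => average n z - h z0)%C.
Proof.
  intros Hl. destruct closed_ball as [r [Hr Hball]].
  assert (HSb : forall n z, D z -> Cmod (average n z - h z0) <= 2).
  { intros n z Hz. eapply Rle_trans; [apply Cmod_minus_le|].
    assert (Cmod (average n z) <= 1) by (apply average_bound; intros; apply h_bound, iter_self, Hz).
    specialize (h_bound z0 z0_in). lra. }
  assert (HSd : forall n z, D z -> exists k, cderiv (fun v => average n v - h z0)%C z k).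
  { intros n z Hz. unfold average, Cdiv.
    destruct (csum_cderiv (fun j v => h (Nat.iter j g v)) z (S n)) as [k Hk].
    { intros j. apply h_iter_diff, Hz. }
    eexists. apply cderiv_minus; [|apply cderiv_const].
    apply cderiv_mult; [exact Hk|apply cderiv_const]. }
  assert (HT : forall n, exists a, taylor (fun w => average n (z0 + w) - h z0)%C r 2 a).
  { intros n. apply (taylor_at (fun v => average n v - h z0)%C); [exact Hr| |].
    - intros z Hz. apply HSd, Hball, Hz.
    - intros z Hz. apply HSb, Hball, Hz. }
  pose (a := fun n => proj1_sig (constructive_indefinite_description _ (HT n))).
  assert (Ha : forall n, taylor (fun w => average n (z0 + w) - h z0)%C r 2 (a n)).
  { intros n. exact (proj2_sig (constructive_indefinite_description _ (HT n))). }
  intros z Hz.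
  apply (vitali D (fun n z => average n z - h z0)%C 2 z0 r); try assumption.
  intros v Hv. replace v with (z0 + (v - z0))%C by ring.
  apply (tends0_of_coefs (fun n w => average n (z0 + w) - h z0)%C r 2 a Hr Ha); [|exact Hv].
  apply (almost_invariant_coefs_tends0 (fun n z => average n z - h z0)%C g z0 l r 2 a r);
    try assumption.
  - intros n. unfold average.
    rewrite (csum_ext _ (fun j => RtoC (INR (S j)) * h z0 - RtoC (INR j) * h z0)%C).
    + rewrite (csum_telescope (fun j => RtoC (INR j) * h z0)%C). simpl (INR 0).
      field. apply RtoC_neq, not_0_INR. lia.
    + intros j _. rewrite iter_fix, S_INR, RtoC_plus. ring.
  - intros u Hu eps He.
    assert (HuD : D u) by (apply Hball; lra).
    destruct (archimed_cor1 (eps / 2)) as [N [HN HN0]]; [lra|].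
    exists N. intros n Hn.
    assert (HnN : INR N <= INR (S n)) by (apply le_INR; lia).
    assert (HN1 : 0 < INR N) by (apply lt_0_INR; lia).
    replace (average n (g u) - h z0 - (average n u - h z0))%C with
      ((h (Nat.iter (S n) g u) - h u) / RtoC (INR (S n)))%C.
    + rewrite Cmod_div, Cmod_R, Rabs_pos_eq by (try apply RtoC_neq; lra).
      apply Rle_lt_trans with (2 * / INR N); [|lra].
      apply Rmult_le_compat; [apply Cmod_ge_0|apply Rlt_le, Rinv_0_lt_compat; lra| |].
      * eapply Rle_trans; [apply Cmod_minus_le|].
        assert (H1 := h_bound _ (iter_self (S n) u HuD)).
        assert (H2 := h_bound _ HuD). lra.
      * apply Rinv_le_contravar; lra.
    + unfold average.
      rewrite (csum_ext (fun j => h (Nat.iter j g (g u))) (fun j => h (Nat.iter (S j) g u))).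
      2: { intros j _. now rewrite Nat.iter_succ_r. }
      rewrite <- (csum_telescope (fun j => h (Nat.iter j g u))).
      rewrite csum_minus. field. apply RtoC_neq. lra.
Qed.

(** Cartan's argument.  If [h (g z) - h z] had a first nonzero coefficient [c] of
   order [m], the telescoping sum [h (g^n z) - h z] would have leading coefficient
   [n c], because [g^j z - z0] is asymptotic to [z - z0]; but these functions are all
   bounded by [2], so their coefficients of order [m] are bounded independently of [n]. *)
Lemma tangent_to_identity : l = 1 -> forall z, D z -> h (g z) = h z.
Proof.
  intros Hl. destruct closed_ball as [r [Hr Hball]].
  set (T := fun z => (h (g z) - h z)%C).
  assert (HTd : forall z, D z -> exists k, cderiv T z k).
  { intros z Hz. destruct (h_iter_diff 1 z Hz) as [k Hk].
    destruct (h_diff z Hz) as [m Hm].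
    eexists. exact (cderiv_minus _ _ _ _ _ Hk Hm). }
  assert (HTb : forall z, D z -> Cmod (T z) <= 2).
  { intros z Hz. eapply Rle_trans; [apply Cmod_minus_le|].
    assert (H1 := h_bound _ (g_self z Hz)). assert (H2 := h_bound _ Hz). lra. }
  destruct (taylor_at T z0 r 2 Hr) as [c Hc].
  { intros z Hz. apply HTd, Hball, Hz. }
  { intros z Hz. apply HTb, Hball, Hz. }
  assert (Hc0 : forall m, c m = 0).
  { intros m. induction m as [m IH] using (well_founded_induction Wf_nat.lt_wf).
    apply NNPP. intros Hcm. assert (Hcp : 0 < Cmod (c m)) by (apply Cmod_gt_0, Hcm).
    assert (Horb : forall j, exists d, 0 < d /\ forall t, 0 < t < d ->
      Cmod (T (Nat.iter j g (z0 + RtoC t)%C) - c m * RtoC t ^ m) <= Cmod (c m) / 2 * t ^ m).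
    { intros j. assert (Hj := iter_mult j). rewrite Hl, Cpow_1_l in Hj.
      destruct (ratio_limit _ z0 1 m (1 / 4) Hj (iter_fix j)) as [d [Hd H]]; [lra|].
      (* The orbit point is at distance at most [2 t] from [z0], so [K t ^ (m + 1)] bounds the
         remainder there. *)
      set (K := 4 * (2 / r) ^ S m).
      assert (HK : 0 <= K).
      { apply Rmult_le_pos; [lra|]. apply pow_le, Rlt_le, Rdiv_lt_0_compat; lra. }
      exists (Rmin (Rmin d (r / 4)) (Cmod (c m) / (4 * (K + 1)))). split.
      { repeat apply Rmin_glb_lt; try lra. apply Rdiv_lt_0_compat; lra. }
      intros t [Ht0 Ht].
      assert (Ht1 := Rlt_le_trans _ _ _ Ht (Rmin_l _ _)).
      assert (Ht2 := Rlt_le_trans _ _ _ Ht (Rmin_r _ _)).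
      assert (Ht3 := Rlt_le_trans _ _ _ Ht1 (Rmin_l _ _)).
      assert (Ht4 := Rlt_le_trans _ _ _ Ht1 (Rmin_r _ _)).
      destruct (H t ltac:(lra)) as [HW1 HW2]. rewrite Cmod_1 in HW1.
      set (W := (Nat.iter j g (z0 + RtoC t)%C - z0)%C) in *.
      replace (Nat.iter j g (z0 + RtoC t)%C) with (z0 + W)%C by (unfold W; ring).
      assert (HR := taylor_half (fun w => T (z0 + w)%C) r 2 c Hr Hc (S m) W ltac:(lra)).
      cbn [taylor_poly] in HR. rewrite taylor_poly_zero in HR by (intros; apply IH; assumption).
      rewrite Cmult_1_l in HW2.
      replace (T (z0 + W) - c m * RtoC t ^ m)%C with
        ((T (z0 + W) - (0 + c m * W ^ m)) + c m * (W ^ m - RtoC t ^ m))%C by ring.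
      eapply Rle_trans; [apply Cmod_triangle|]. rewrite (Cmod_mult (c m)).
      assert (Hp : 0 < t ^ m) by (apply pow_lt, Ht0).
      assert (HKt : 2 * 2 * (Cmod W / r) ^ S m <= K * t * t ^ m).
      { replace (K * t * t ^ m) with (2 * 2 * (2 * t / r) ^ S m).
        - apply Rmult_le_compat_l; [lra|]. apply pow_incr. split.
          + apply Rmult_le_pos; [apply Cmod_ge_0|apply Rlt_le, Rinv_0_lt_compat, Hr].
          + apply Rmult_le_compat_r; [apply Rlt_le, Rinv_0_lt_compat, Hr|lra].
        - unfold K, Rdiv. rewrite !Rpow_mult_distr. simpl. ring. }
      assert (HKc : K * t <= Cmod (c m) / 4).
      { apply Rlt_le, Rle_div_r in Ht2; [|lra].
        apply Rle_trans with ((K + 1) * t); [apply Rmult_le_compat_r; lra|]. lra. }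
      assert (K * t * t ^ m <= Cmod (c m) / 4 * t ^ m) by (apply Rmult_le_compat_r; lra).
      assert (Cmod (c m) * Cmod (W ^ m - RtoC t ^ m) <= Cmod (c m) * (1 / 4 * t ^ m))
        by (apply Rmult_le_compat_l; lra).
      lra. }
    assert (Hsum : forall n, exists d, 0 < d /\ forall t, 0 < t < d ->
      Cmod (h (Nat.iter n g (z0 + RtoC t)%C) - h (z0 + RtoC t)%C
             - RtoC (INR n) * (c m * RtoC t ^ m)) <= INR n * (Cmod (c m) / 2 * t ^ m)).
    { induction n as [|n [d1 [Hd1 H1]]].
      - exists 1. split; [lra|]. intros t _. simpl.
        replace (h (z0 + RtoC t) - h (z0 + RtoC t) - 0 * (c m * RtoC t ^ m))%C with (RtoC 0) by ring.
        rewrite Cmod_0. lra.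
      - destruct (Horb n) as [d2 [Hd2 H2]]. exists (Rmin d1 d2).
        split; [apply Rmin_glb_lt; assumption|]. intros t [Ht0 Ht].
        specialize (H1 t (conj Ht0 (Rlt_le_trans _ _ _ Ht (Rmin_l _ _)))).
        specialize (H2 t (conj Ht0 (Rlt_le_trans _ _ _ Ht (Rmin_r _ _)))).
        rewrite S_INR, RtoC_plus. simpl Nat.iter. unfold T in H2.
        set (v := Nat.iter n g (z0 + RtoC t)%C) in *.
        replace (h (g v) - h (z0 + RtoC t) - (RtoC (INR n) + 1) * (c m * RtoC t ^ m))%C with
          ((h v - h (z0 + RtoC t) - RtoC (INR n) * (c m * RtoC t ^ m)) +
           (h (g v) - h v - c m * RtoC t ^ m))%C by ring.
        eapply Rle_trans; [apply Cmod_triangle|]. lra. }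
    assert (Hbnd : forall n, INR n * Cmod (c m) <= 8 * (/ r) ^ m).
    { intros n. destruct (Hsum n) as [d [Hd H]].
      set (Q := fun z => (h (Nat.iter n g z) - h z)%C).
      destruct (taylor_at Q z0 r 2 Hr) as [b Hb].
      { intros z Hz. destruct (h_iter_diff n z (Hball z Hz)) as [k Hk].
        destruct (h_diff z (Hball z Hz)) as [k' Hk'].
        eexists. exact (cderiv_minus _ _ _ _ _ Hk Hk'). }
      { intros z Hz. eapply Rle_trans; [apply Cmod_minus_le|].
        assert (H1 := h_bound _ (iter_self n z (Hball z Hz))).
        assert (H2 := h_bound _ (Hball z Hz)). lra. }
      assert (Hn0 : 0 <= INR n) by apply pos_INR.
      assert (Hmod : forall t, 0 < t ->
        Cmod (RtoC (INR n) * (c m * RtoC t ^ m)) = INR n * (Cmod (c m) * t ^ m)).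
      { intros t Ht. rewrite !Cmod_mult, Cmod_pow, !Cmod_R, !Rabs_pos_eq by lra. reflexivity. }
      (* At one small [t] the value of [Q], which is [n (c m) t ^ m] up to half of its size, obeys the
         Schwarz estimate of order [m] for functions bounded by [2]. *)
      set (t := Rmin (d / 2) (r / 2)).
      assert (Ht0 : 0 < t) by (apply Rmin_glb_lt; lra).
      assert (Ht1 : t <= d / 2) by apply Rmin_l.
      assert (Ht2 : t <= r / 2) by apply Rmin_r.
      assert (Hord : Cmod (Q (z0 + RtoC t)%C) <= 2 * (t / r) ^ m * (r / (r - t))).
      { replace t with (Cmod (RtoC t)) at 2 3 by (rewrite Cmod_R, Rabs_pos_eq; lra).
        apply (taylor_order (fun w => Q (z0 + w)%C) r 2 b m (2 * INR n * Cmod (c m)) Hr Hb).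
        - exists d. split; [exact Hd|]. intros s Hs. specialize (H s Hs). fold (Q (z0 + RtoC s)%C) in H.
          pose proof (Cmod_rev_triangle (Q (z0 + RtoC s)%C) (RtoC (INR n) * (c m * RtoC s ^ m))%C).
          rewrite (Hmod s) in H0 by lra.
          assert (0 <= INR n * (Cmod (c m) * s ^ m)).
          { apply Rmult_le_pos; [lra|]. apply Rmult_le_pos; [lra|apply pow_le; lra]. }
          lra.
        - rewrite Cmod_R, Rabs_pos_eq; lra. }
      specialize (H t ltac:(lra)). fold (Q (z0 + RtoC t)%C) in H.
      rewrite Cmod_minus_sym in H.
      pose proof (Cmod_rev_triangle (RtoC (INR n) * (c m * RtoC t ^ m))%C (Q (z0 + RtoC t)%C)) as Hrt.
      rewrite (Hmod t Ht0) in Hrt.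
      assert (Hp : 0 < t ^ m) by (apply pow_lt, Ht0).
      assert (Hfac : r / (r - t) <= 2) by (apply Rle_div_l; lra).
      assert (Hpr : 0 <= (t / r) ^ m).
      { apply pow_le, Rlt_le, Rdiv_lt_0_compat; lra. }
      assert (Hfin : 2 * (t / r) ^ m * (r / (r - t)) <= 2 * (t / r) ^ m * 2)
        by (apply Rmult_le_compat_l; lra).
      unfold Rdiv in Hfin at 3. rewrite Rpow_mult_distr in Hfin.
      apply Rmult_le_reg_r with (1 := Hp). lra. }
    destruct (INR_unbounded (8 * (/ r) ^ m / Cmod (c m))) as [n Hn].
    specialize (Hbnd n). apply Rlt_div_l in Hn; lra. }
  intros z Hz. apply Cminus_eq_0.
  apply (identity_theorem D T 2 z0 r); try assumption.
  intros v Hv. apply tends0_const.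
  replace v with (z0 + (v - z0))%C by ring.
  apply (tends0_of_coefs (fun _ w => T (z0 + w)%C) r 2 (fun _ => c) Hr); [intros; exact Hc| |exact Hv].
  intros k. rewrite Hc0. apply tends0_zero.
Qed.

End Iteration.

(** * Julia's lemma in a half-plane *)

(** It compares the distances from [u] to [b] and to the reflection of [b] in the imaginary axis. *)
Lemma Cmod_reflect (u b : C) :
  Cmod (u + Cconj b) ^ 2 - Cmod (u - b) ^ 2 = 4 * (Re u * Re b).
Proof. rewrite !Cmod2_alt. destruct u, b; simpl. ring. Qed.

Lemma reflect_lt (u b : C) : 0 < Re u -> 0 < Re b -> Cmod (u - b) < Cmod (u + Cconj b).
Proof.
  intros Hu Hb. pose proof (Cmod_reflect u b) as E.
  assert (0 < Re u * Re b) by (apply Rmult_lt_0_compat; assumption).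
  pose proof (Cmod_ge_0 (u - b)). pose proof (Cmod_ge_0 (u + Cconj b)).
  apply Rnot_le_lt. intros H2. assert (Cmod (u + Cconj b) ^ 2 <= Cmod (u - b) ^ 2).
  { apply pow_incr. split; assumption. }
  lra.
Qed.

(** This is the Schwarz lemma after Cayley transforms of both
   half-planes that send [x] and [F x] to [0]. *)
Lemma schwarz_pick_half_plane (F : C -> C) K x :
  (forall z, K < Re z -> exists l, cderiv F z l) ->
  (forall z, K < Re z -> 0 < Re (F z)) -> K < x ->
  forall z, K < Re z ->
  Cmod (F z - F (RtoC x)) * Cmod (z + RtoC (x - 2 * K)) <=
  Cmod (z - RtoC x) * Cmod (F z + Cconj (F (RtoC x))).
Proof.
  intros HF HR Hx z Hz.
  set (a := x - K). assert (Ha : 0 < a) by (unfold a; lra).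
  set (b := F (RtoC x)).
  assert (Hb : 0 < Re b) by (apply HR; simpl; lra).
  set (phi := fun w => (RtoC K + RtoC a * ((1 + w) * / (1 - w)))%C).
  assert (H1w : forall w, Cmod w < 1 -> (1 - w <> 0)%C).
  { intros w Hw. apply Cmod_gt_0. pose proof (Cmod_rev_triangle 1 w). rewrite Cmod_1 in *. lra. }
  assert (Hphi : forall w, Cmod w < 1 -> K < Re (phi w)).
  { intros w Hw. assert (Hw1 := H1w w Hw).
    (* With [P = phi w - K] one has [w = (P - a) / (P + a)], so that [|w| < 1] says that [P] is
       closer to [a] than to [- a]. *)
    set (P := (phi w - RtoC K)%C).
    assert (EP : (P + RtoC a = RtoC (2 * a) * / (1 - w))%C).
    { unfold P, phi. rewrite RtoC_mult. field. exact Hw1. }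
    assert (EM : (P - RtoC a = w * (P + RtoC a))%C).
    { rewrite EP. unfold P, phi. rewrite RtoC_mult. field. exact Hw1. }
    assert (Hpos : 0 < Cmod (P + RtoC a)).
    { rewrite EP. apply Cmod_gt_0, Cmult_neq_0.
      - apply RtoC_neq; lra.
      - intro E. apply Hw1. rewrite <- (Cmult_1_r (1 - w)).
        replace (RtoC 1) with ((1 - w) * / (1 - w))%C at 2 by (field; exact Hw1).
        rewrite E. ring. }
    pose proof (Cmod_reflect P (RtoC a)) as E.
    replace (Cconj (RtoC a)) with (RtoC a) in E by (apply injective_projections; simpl; ring).
    rewrite EM, Cmod_mult in E. simpl (Re (RtoC a)) in E.
    assert (Hlt : Cmod w * Cmod (P + RtoC a) < Cmod (P + RtoC a)).
    { rewrite <- (Rmult_1_l (Cmod (P + RtoC a))) at 2. apply Rmult_lt_compat_r; assumption. }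
    pose proof (Cmod_ge_0 w).
    assert (0 <= Cmod w * Cmod (P + RtoC a)) by (apply Rmult_le_pos; lra).
    assert (HPa : 0 < Re P * a).
    { set (A := Cmod w * Cmod (P + RtoC a)) in *. set (A' := Cmod (P + RtoC a)) in *.
      clearbody A A'. nra. }
    assert (HP : 0 < Re P) by (apply Rnot_le_lt; intro; nra).
    unfold P in HP. simpl in HP. simpl. lra. }
  set (Phi := fun w => ((F (phi w) - b) * / (F (phi w) + Cconj b))%C).
  assert (Hden : forall u, 0 < Re u -> (u + Cconj b <> 0)%C).
  { intros u Hu E. apply (f_equal Re) in E. destruct u, b; simpl in *. lra. }
  assert (Hph0 : phi 0 = RtoC x).
  { unfold phi, a. rewrite RtoC_minus. field. }
  set (w := ((z - RtoC x) * / (z + RtoC (x - 2 * K)))%C).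
  assert (Hq : 0 < Cmod (z + RtoC (x - 2 * K))).
  { apply Cmod_gt_0. intro E. apply (f_equal Re) in E. destruct z; simpl in *. lra. }
  assert (Hq0 := proj2 (Cmod_gt_0 _) Hq).
  assert (Hw : Cmod w = Cmod (z - RtoC x) / Cmod (z + RtoC (x - 2 * K))).
  { unfold w. rewrite Cmod_mult, Cmod_inv by assumption. reflexivity. }
  assert (Hw1 : Cmod w < 1).
  { rewrite Hw. apply Rlt_div_l; [exact Hq|]. rewrite Rmult_1_l.
    pose proof (reflect_lt (z - RtoC K)%C (RtoC a)) as H.
    replace (z - RtoC K - RtoC a)%C with (z - RtoC x)%C in H
      by (unfold a; rewrite RtoC_minus; ring).
    replace (z - RtoC K + Cconj (RtoC a))%C with (z + RtoC (x - 2 * K))%C in H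
      by (unfold a; apply injective_projections; simpl; ring).
    apply H; unfold Re in *; simpl; lra. }
  assert (Hphw : phi w = z).
  { assert (Ha0 : RtoC a <> 0) by (apply RtoC_neq; lra).
    assert (Ex : RtoC (x - 2 * K) = (RtoC a - RtoC K)%C)
      by (rewrite <- RtoC_minus; f_equal; unfold a; ring).
    assert (Ex2 : RtoC x = (RtoC a + RtoC K)%C)
      by (rewrite <- RtoC_plus; f_equal; unfold a; ring).
    assert (Hq1 : (z + (RtoC a - RtoC K) <> 0)%C) by (rewrite <- Ex; exact Hq0).
    assert (E : (1 - w = 2 * RtoC a * / (z + (RtoC a - RtoC K)))%C).
    { unfold w. rewrite Ex, Ex2. field. exact Hq1. }
    unfold phi. rewrite E. unfold w. rewrite Ex, Ex2. field.
    repeat split; assumption. }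
  pose proof (schwarz Phi) as HS.
  assert (Hineq : Cmod (Phi w) <= Cmod w).
  { apply HS; [| | |exact Hw1].
    - intros v Hv. assert (Hv1 := H1w v Hv).
      destruct (HF (phi v) (Hphi v Hv)) as [k Hk].
      assert (Hp : exists m, cderiv phi v m).
      { eexists. unfold phi. apply cderiv_plus; [apply cderiv_const|].
        apply cderiv_mult; [apply cderiv_const|].
        apply cderiv_mult; [apply cderiv_plus; [apply cderiv_const|apply cderiv_id]|].
        apply (cderiv_comp Cinv (fun v => 1 - v)%C); [apply cderiv_inv, Hv1|].
        apply cderiv_minus; [apply cderiv_const|apply cderiv_id]. }
      destruct Hp as [m Hm].
      assert (HFp := cderiv_comp F phi v k m Hk Hm).
      eexists. unfold Phi. apply cderiv_mult.
      + apply cderiv_minus; [exact HFp|apply cderiv_const].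
      + apply (cderiv_comp Cinv (fun v => F (phi v) + Cconj b)%C).
        * apply cderiv_inv, Hden, HR, Hphi, Hv.
        * apply cderiv_plus; [exact HFp|apply cderiv_const].
    - intros v Hv. assert (Hu := HR _ (Hphi v Hv)).
      unfold Phi. rewrite Cmod_mult, Cmod_inv by (apply Hden, Hu).
      apply Rle_div_l; [apply Cmod_gt_0, Hden, Hu|].
      rewrite Rmult_1_l. apply Rlt_le, reflect_lt; assumption.
    - unfold Phi. rewrite Hph0. fold b. ring. }
  unfold Phi in Hineq. rewrite Hphw, Hw, Cmod_mult, Cmod_inv in Hineq
    by (apply Hden, HR, Hz).
  assert (Hd : 0 < Cmod (F z + Cconj b)) by (apply Cmod_gt_0, Hden, HR, Hz).
  apply (proj1 (Rle_div_l (Cmod (F z - b)) _ _ Hd)) in Hineq.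
  replace (Cmod (z - RtoC x) * Cmod (F z + Cconj b)) with
    ((Cmod (z - RtoC x) / Cmod (z + RtoC (x - 2 * K)) * Cmod (F z + Cconj b)) *
     Cmod (z + RtoC (x - 2 * K))) by (field; lra).
  apply Rmult_le_compat_r; [lra|exact Hineq].
Qed.

(** Let the base point [x] of the Schwarz-Pick inequality tend to infinity.  Squared and
   combined with [Cmod_reflect], that inequality reads
   [(Re z - K) (x - K) |F z + conj (F x)| ^ 2 <= Re (F z) Re (F x) |z + x - 2 K| ^ 2],
   in which every quantity that depends on [x] is asymptotic to a power of [x]. *)
Lemma julia (F : C -> C) K :
  (forall z, K < Re z -> exists l, cderiv F z l) ->
  (forall z, K < Re z -> 0 < Re (F z)) ->
  (forall eps, 0 < eps -> exists X, forall x, X < x ->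
     Cmod (F (RtoC x) - RtoC x) <= eps * x) ->
  forall z, K < Re z -> Re z - K <= Re (F z).
Proof.
  intros HF HR Hasym z Hz.
  set (s := Re z - K). set (q := Re (F z)).
  assert (Hs : 0 < s) by (unfold s; lra).
  assert (Hq : 0 < q) by (apply HR, Hz).
  apply Rminus_le.
  apply small_le_zero with (6 * s + 7 * q).
  exists (1 / 2). split; [lra|]. intros e He.
  destruct (Hasym e ltac:(lra)) as [X HX].
  (* For [x >= B / e] every constant in the inequality is at most [e x]. *)
  set (B := Cmod (z - RtoC (2 * K)) + Rabs K + Cmod (F z) + 1).
  pose proof (Cmod_ge_0 (z - RtoC (2 * K))). pose proof (Cmod_ge_0 (F z)).
  pose proof (Rabs_pos K). pose proof (Rle_abs K).
  assert (HB : 0 < B) by (unfold B; lra).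
  set (x := Rmax (X + 1) (B / e)).
  assert (Hx1 : X < x) by (pose proof (Rmax_l (X + 1) (B / e)); unfold x; lra).
  assert (Hx2 : B / e <= x) by apply Rmax_r. clearbody x.
  apply Rle_div_l in Hx2; [|lra].
  assert (Hx0 : 0 < x) by nra.
  assert (HxK : K < x) by (unfold B in *; nra).
  specialize (HX x Hx1).
  pose proof (schwarz_pick_half_plane F K x HF HR HxK z Hz) as HP.
  set (b := F (RtoC x)) in *.
  pose proof (Cmod_reflect (F z) b) as E1.
  pose proof (Cmod_reflect (z - RtoC K)%C (RtoC (x - K))) as E2.
  replace (z - RtoC K - RtoC (x - K))%C with (z - RtoC x)%C in E2
    by (rewrite RtoC_minus; ring).
  replace (z - RtoC K + Cconj (RtoC (x - K)))%C with (z + RtoC (x - 2 * K))%C in E2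
    by (apply injective_projections; simpl; ring).
  replace (Re (z - RtoC K)) with s in E2 by (unfold s, Re; simpl; ring).
  simpl (Re (RtoC (x - K))) in E2. fold q in E1.
  assert (Hbx : Re b <= (1 + e) * x).
  { pose proof (re_le_Cmod (b - RtoC x)%C) as Hre. pose proof (Rle_abs (Re (b - RtoC x)%C)).
    assert (Eb : Re (b - RtoC x)%C = Re b - x) by (unfold Re; simpl; ring). rewrite Eb in *. lra. }
  assert (Hb0 : 0 < Re b) by (apply HR; simpl; lra).
  assert (HQ : (1 - 2 * e) * x <= Cmod (F z + Cconj b)).
  { assert (Hbm : Cmod b >= (1 - e) * x).
    { pose proof (Cmod_rev_triangle (RtoC x) b) as Hr.
      rewrite Cmod_minus_sym, Cmod_R, Rabs_pos_eq in Hr by lra.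
      lra. }
    pose proof (Cmod_rev_triangle (Cconj b) (- F z)%C) as Hr.
    rewrite Cmod_conj, Cmod_opp in Hr.
    replace (Cconj b - - F z)%C with (F z + Cconj b)%C in Hr by ring.
    unfold B in Hx2. lra. }
  assert (Hqx : Cmod (z + RtoC (x - 2 * K)) <= (1 + e) * x).
  { replace (z + RtoC (x - 2 * K))%C with ((z - RtoC (2 * K)) + RtoC x)%C
      by (apply injective_projections; simpl; ring).
    eapply Rle_trans; [apply Cmod_triangle|]. rewrite Cmod_R, Rabs_pos_eq by lra.
    unfold B in Hx2. lra. }
  pose proof (Cmod_ge_0 (F z - b)). pose proof (Cmod_ge_0 (z - RtoC x)).
  pose proof (Cmod_ge_0 (F z + Cconj b)). pose proof (Cmod_ge_0 (z + RtoC (x - 2 * K))).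
  set (P := Cmod (F z - b)) in *. set (Q := Cmod (F z + Cconj b)) in *.
  set (p := Cmod (z - RtoC x)) in *. set (c := Cmod (z + RtoC (x - 2 * K))) in *.
  assert (HP2 : P ^ 2 * c ^ 2 <= p ^ 2 * Q ^ 2).
  { rewrite <- !Rpow_mult_distr. apply pow_incr. split; [apply Rmult_le_pos; assumption|exact HP]. }
  assert (Hkey : s * (x - K) * Q ^ 2 <= q * Re b * c ^ 2) by nra.
  assert (HxK' : (1 - e) * x <= x - K) by (unfold B in Hx2; nra).
  assert (HA : s * ((1 - e) * x) * ((1 - 2 * e) * x) ^ 2 <= s * (x - K) * Q ^ 2).
  { apply Rmult_le_compat.
    - apply Rmult_le_pos; nra.
    - apply pow_le; nra.
    - apply Rmult_le_compat_l; lra.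
    - apply pow_incr. split; nra. }
  assert (HC : q * Re b * c ^ 2 <= q * ((1 + e) * x) * ((1 + e) * x) ^ 2).
  { apply Rmult_le_compat.
    - apply Rmult_le_pos; lra.
    - apply pow_le; lra.
    - apply Rmult_le_compat_l; lra.
    - apply pow_incr. split; lra. }
  assert (Hx3 : 0 < x ^ 3) by (apply pow_lt, Hx0).
  (* Both sides carry the factor [x ^ 3]; the polynomials in [e] are then linearised on [(0, 1 / 2)]. *)
  assert (Hfin : s * ((1 - e) * (1 - 2 * e) ^ 2) <= q * (1 + e) ^ 3).
  { apply Rmult_le_reg_r with (1 := Hx3). nra. }
  assert (Hl : 1 - 6 * e <= (1 - e) * (1 - 2 * e) ^ 2) by nra.
  assert (Hu : (1 + e) ^ 3 <= 1 + 7 * e) by nra.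
  assert (s * (1 - 6 * e) <= s * ((1 - e) * (1 - 2 * e) ^ 2)) by (apply Rmult_le_compat_l; lra).
  assert (q * (1 + e) ^ 3 <= q * (1 + 7 * e)) by (apply Rmult_le_compat_l; lra).
  lra.
Qed.

(** * Rigidity in a domain containing a half-plane *)

(** An injective holomorphic function with values in the unit disc on the right
   half-plane, small far to the right: bounded data for maps that are themselves unbounded. *)
Definition inv1p (z : C) : C := (/ (1 + z))%C.

Lemma one_plus_neq z : 0 < Re z -> (1 + z <> 0)%C.
Proof. intros H E. apply (f_equal Re) in E. unfold Re in *. simpl in *. lra. Qed.

Lemma inv1p_bound c z : 0 <= c < Re z -> Cmod (inv1p z) <= / (1 + c).
Proof.
  intros Hc. unfold inv1p. rewrite Cmod_inv by (apply one_plus_neq; lra).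
  apply Rinv_le_contravar; [lra|].
  pose proof (re_le_Cmod (1 + z)%C) as H. pose proof (Rle_abs (Re (1 + z)%C)).
  unfold Re in *. simpl in *. lra.
Qed.

Lemma inv1p_diff z : 0 < Re z -> exists l, cderiv inv1p z l.
Proof.
  intros Hz. eexists. apply (cderiv_comp Cinv (fun v => 1 + v)%C).
  - apply cderiv_inv, one_plus_neq, Hz.
  - apply cderiv_plus; [apply cderiv_const|apply cderiv_id].
Qed.

Lemma inv1p_inj z w : 0 < Re z -> 0 < Re w -> inv1p z = inv1p w -> z = w.
Proof.
  intros Hz Hw H. apply one_plus_neq in Hz, Hw. unfold inv1p in H.
  assert (E : (1 + z = 1 + w)%C).
  { transitivity ((1 + z) * (/ (1 + w)) * (1 + w))%C; [|rewrite <- H]; field; assumption. }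
  apply (f_equal (fun u => u - 1)%C) in E. ring_simplify in E.
  replace z with (1 + z - 1)%C by ring. replace w with (1 + w - 1)%C by ring.
  now rewrite E.
Qed.

(** Put [e z = g z - z].  Being bounded by [x / (24 q)] on a disc of radius [x / 2], [e] has
   Lipschitz constant at most [1 / (6 q)] near the centre, so each of the [q] displacements along
   the orbit of [a] differs from [e a] by at most half of [|e a|].  Their sum is zero, and it
   differs from [q (e a)] by at most half of [q |e a|]. *)
Lemma periodic_near_identity (g : C -> C) q x : (0 < q)%nat -> 0 < x ->
  (forall z, Cmod (z - RtoC x) <= x / 2 -> exists l, cderiv g z l) ->
  (forall z, Cmod (z - RtoC x) <= x / 2 -> Cmod (g z - z) <= / (24 * INR q) * x) ->
  (forall z, Cmod (z - RtoC x) <= x / 2 -> Nat.iter q g z = z) ->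
  forall a, Cmod (a - RtoC x) < x / 16 -> g a = a.
Proof.
  intros Hq Hx Hd He Hper a Ha.
  assert (HQ : 1 <= INR q) by (apply (le_INR 1); lia).
  set (eps := / (24 * INR q)) in *.
  assert (Heps : 0 < eps) by (apply Rinv_0_lt_compat; lra).
  assert (HepsQ : eps * INR q = 1 / 24) by (unfold eps; field; lra).
  set (e := fun z => (g z - z)%C).
  set (d := Cmod (e a)). assert (Hd0 : 0 <= d) by apply Cmod_ge_0.
  assert (Hdx : d <= eps * x) by (apply He; lra).
  assert (Hlip : forall b, Cmod (b - a) <= x / 16 -> Cmod (e b - e a) <= 4 * eps * Cmod (b - a)).
  { intros b Hb.
    assert (Hin : forall z, Cmod (z - a) <= 3 * x / 8 -> Cmod (z - RtoC x) <= x / 2).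
    { intros z Hz. replace (z - RtoC x)%C with ((z - a) + (a - RtoC x))%C by ring.
      eapply Rle_trans; [apply Cmod_triangle|lra]. }
    eapply Rle_trans; [apply (lipschitz_of_bound e a (3 * x / 8) (eps * x))|].
    - lra.
    - intros z Hz. destruct (Hd z (Hin z Hz)) as [l Hl].
      eexists. apply cderiv_minus; [exact Hl|apply cderiv_id].
    - intros z Hz. apply He, Hin, Hz.
    - lra.
    - pose proof (Cmod_ge_0 (b - a)). apply Rle_div_l; [lra|].
      assert (0 <= eps * Cmod (b - a)) by (apply Rmult_le_pos; lra). nra. }
  assert (Horb : forall j, (j <= q)%nat ->
    Cmod (Nat.iter j g a - a - RtoC (INR j) * e a) <= INR j * (d / 2)).
  { induction j as [|j IH]; intros Hj.
    - simpl. replace (a - a - 0 * e a)%C with (RtoC 0) by ring. rewrite Cmod_0. lra.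
    - specialize (IH ltac:(lia)). set (b := Nat.iter j g a) in *.
      assert (Hj0 : 0 <= INR j) by apply pos_INR.
      assert (Hjq : INR j <= INR q) by (apply le_INR; lia).
      assert (Hba : Cmod (b - a) <= 3 / 2 * (INR q * d)).
      { replace (b - a)%C with ((b - a - RtoC (INR j) * e a) + RtoC (INR j) * e a)%C by ring.
        eapply Rle_trans; [apply Cmod_triangle|].
        rewrite Cmod_mult, Cmod_R, Rabs_pos_eq by lra. fold d.
        assert (INR j * d <= INR q * d) by (apply Rmult_le_compat_r; lra). lra. }
      assert (Hqd : INR q * d <= x / 24).
      { apply Rle_trans with (INR q * (eps * x)); [apply Rmult_le_compat_l; lra|].
        replace (INR q * (eps * x)) with (eps * INR q * x) by ring. rewrite HepsQ. lra. }
      specialize (Hlip b ltac:(lra)).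
      rewrite S_INR, RtoC_plus. simpl Nat.iter. fold b.
      replace (g b - a - (RtoC (INR j) + 1) * e a)%C with
        ((b - a - RtoC (INR j) * e a) + (e b - e a))%C by (unfold e; ring).
      eapply Rle_trans; [apply Cmod_triangle|].
      assert (4 * eps * Cmod (b - a) <= 4 * eps * (3 / 2 * (INR q * d)))
        by (apply Rmult_le_compat_l; lra).
      replace (4 * eps * (3 / 2 * (INR q * d))) with (6 * (eps * INR q) * d) in H by field.
      rewrite HepsQ in H. lra. }
  specialize (Horb q (Nat.le_refl q)).
  rewrite Hper in Horb by lra.
  replace (a - a - RtoC (INR q) * e a)%C with (- (RtoC (INR q) * e a))%C in Horb by ring.
  rewrite Cmod_opp, Cmod_mult, Cmod_R, Rabs_pos_eq in Horb by lra. fold d in Horb.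
  apply Cminus_eq_0, Cmod_eq_0. fold (e a) d. nra.
Qed.

Theorem half_plane_rigidity (E : C -> Prop) (g : C -> C) (z0 : C) (K : R) :
  open E -> connected_set E ->
  (forall z, E z -> 0 < Re z) -> (forall z, K < Re z -> E z) ->
  (forall z, E z -> E (g z)) -> (forall z, E z -> exists l, cderiv g z l) ->
  E z0 -> g z0 = z0 ->
  (forall eps, 0 < eps -> exists X, forall x z, X < x ->
     Cmod (z - RtoC x) <= x / 2 -> Cmod (g z - z) <= eps * x) ->
  forall z, E z -> g z = z.
Proof.
  intros HO HC Hpos HK Hself Hdiff Hz0 Hfix Hasym.
  assert (HK0 : 0 <= K).
  { apply Rnot_lt_le. intros Hlt. specialize (Hpos (RtoC (K / 2)) (HK (RtoC (K / 2)) ltac:(unfold Re; simpl; lra))).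
    unfold Re in Hpos. simpl in Hpos. lra. }
  assert (Hiter : forall n eps, 0 < eps -> exists X, forall x, X < x ->
    Cmod (Nat.iter n g (RtoC x) - RtoC x) <= eps * x).
  { induction n as [|n IH]; intros eps He.
    - exists 0. intros x Hx. simpl. replace (RtoC x - RtoC x)%C with (RtoC 0) by ring.
      rewrite Cmod_0. nra.
    - destruct (IH (Rmin (1 / 2) (eps / 2))) as [X1 H1]; [apply Rmin_glb_lt; lra|].
      destruct (Hasym (eps / 2)) as [X2 H2]; [lra|].
      exists (Rmax (Rmax X1 X2) 0). intros x Hx.
      pose proof (Rmax_l (Rmax X1 X2) 0). pose proof (Rmax_r (Rmax X1 X2) 0).
      pose proof (Rmax_l X1 X2). pose proof (Rmax_r X1 X2).
      specialize (H1 x ltac:(lra)).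
      pose proof (Rmin_l (1 / 2) (eps / 2)). pose proof (Rmin_r (1 / 2) (eps / 2)).
      assert (Rmin (1 / 2) (eps / 2) * x <= 1 / 2 * x) by (apply Rmult_le_compat_r; lra).
      assert (Rmin (1 / 2) (eps / 2) * x <= eps / 2 * x) by (apply Rmult_le_compat_r; lra).
      specialize (H2 x (Nat.iter n g (RtoC x)) ltac:(lra) ltac:(lra)).
      simpl Nat.iter. set (b := Nat.iter n g (RtoC x)) in *.
      replace (g b - RtoC x)%C with ((g b - b) + (b - RtoC x))%C by ring.
      eapply Rle_trans; [apply Cmod_triangle|lra]. }
  assert (Hjulia : forall n z, K < Re z -> Re z - K <= Re (Nat.iter n g z)).
  { intros n. apply julia.
    - intros z Hz. apply (iter_diff E g Hself Hdiff), HK, Hz.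
    - intros z Hz. apply Hpos, iter_self, HK, Hz. exact Hself.
    - intros eps He. exact (Hiter n eps He). }
  assert (Hhd : forall z, E z -> exists l, cderiv inv1p z l) by (intros; apply inv1p_diff, Hpos; assumption).
  assert (Hhb : forall z, E z -> Cmod (inv1p z) <= 1).
  { intros z Hz. replace 1 with (/ (1 + 0)) by (field; lra). apply inv1p_bound.
    specialize (Hpos z Hz). lra. }
  destruct (Hdiff z0 Hz0) as [l Hl].
  destruct (classic (exists q, (0 < q)%nat /\ (l ^ q)%C = 1)) as [[q [Hq Hlq]]|Hnr].
  - assert (Hper : forall z, E z -> Nat.iter q g z = z).
    { intros z Hz.
      assert (Hqz := iter_self E g Hself q z Hz).
      apply inv1p_inj; [apply Hpos, Hqz|apply Hpos, Hz|].
      apply (tangent_to_identity E (Nat.iter q g) z0 (l ^ q)%C HO HC); try assumption.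
      - apply iter_self, Hself.
      - apply iter_diff; assumption.
      - apply iter_fix, Hfix.
      - apply iter_mult; assumption. }
    destruct (Hasym (/ (24 * INR q))) as [X HX].
    { apply Rinv_0_lt_compat. assert (0 < INR q) by (apply lt_0_INR; exact Hq). lra. }
    (* Beyond [2 K] the disc of radius [x / 2] about [x] lies in [{Re z > K}]. *)
    set (x := Rmax X (2 * K) + 1).
    assert (Hx1 : X < x) by (pose proof (Rmax_l X (2 * K)); unfold x; lra).
    assert (Hx2 : 2 * K < x) by (pose proof (Rmax_r X (2 * K)); unfold x; lra).
    clearbody x.
    assert (Hball : forall z, Cmod (z - RtoC x) <= x / 2 -> E z).
    { intros z Hz. apply HK. pose proof (re_le_Cmod (z - RtoC x)%C) as Hre.
      pose proof (Rcomplements.Rabs_le_between (Re (z - RtoC x)%C) (x / 2)) as Hb.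
      assert (Hb' := proj1 Hb ltac:(lra)). unfold Re in *. simpl in *.
      destruct (Req_dec (fst z) (x / 2)); lra. }
    assert (Hloc : forall a, Cmod (a - RtoC x) < x / 16 -> g a = a).
    { apply (periodic_near_identity g q x Hq); [lra| | |].
      - intros z Hz. apply Hdiff, Hball, Hz.
      - intros z Hz. apply HX; assumption.
      - intros z Hz. apply Hper, Hball, Hz. }
    intros z Hz. apply inv1p_inj; [apply Hpos, Hself, Hz|apply Hpos, Hz|].
    apply Cminus_eq_0.
    apply (identity_theorem E (fun z => inv1p (g z) - inv1p z)%C 2 (RtoC x) (x / 16) HO HC).
    + intros v Hv. destruct (Hdiff v Hv) as [k Hk].
      destruct (Hhd _ (Hself v Hv)) as [m Hm]. destruct (Hhd v Hv) as [m' Hm'].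
      eexists. exact (cderiv_minus _ _ _ _ _ (cderiv_comp inv1p g v m k Hm Hk) Hm').
    + intros v Hv. eapply Rle_trans; [apply Cmod_minus_le|].
      assert (H1 := Hhb _ (Hself v Hv)). assert (H2 := Hhb _ Hv). lra.
    + apply Hball. replace (RtoC x - RtoC x)%C with (RtoC 0) by ring. rewrite Cmod_0. lra.
    + lra.
    + intros v Hv. rewrite (Hloc v Hv). ring.
    + exact Hz.
  - exfalso.
    assert (Hav := average_nonresonant E g z0 l HO HC Hself Hdiff Hz0 Hfix Hl inv1p Hhd Hhb).
    assert (Hne := one_plus_neq z0 (Hpos z0 Hz0)).
    assert (Hm : 0 < Cmod (1 + z0)) by (apply Cmod_gt_0, Hne).
    (* From this [x] on, [h] is below [|h z0| / 2] along the whole orbit. *)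
    set (x := K + 2 * Cmod (1 + z0) + 1).
    assert (Hbnd : forall j, Cmod (inv1p (Nat.iter j g (RtoC x))) <= / (1 + 2 * Cmod (1 + z0))).
    { intros j. apply inv1p_bound.
      assert (Hj := Hjulia j (RtoC x) ltac:(unfold x, Re; simpl; lra)).
      change (Re (RtoC x)) with x in Hj.
      unfold x in *. lra. }
    assert (Hh0 : Cmod (inv1p z0) = / Cmod (1 + z0)) by (unfold inv1p; apply Cmod_inv, Hne).
    destruct (Hav) with (z := RtoC x) (eps := / (2 * Cmod (1 + z0))) as [N HN].
    { intros m Hm0 E1. apply Hnr. now exists m. }
    { apply HK. change (Re (RtoC x)) with x. unfold x. lra. }
    { apply Rinv_0_lt_compat. lra. }
    specialize (HN N (Nat.le_refl N)).
    assert (Hb := average_bound g inv1p N (RtoC x) _ Hbnd).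
    rewrite Cmod_minus_sym in HN.
    pose proof (Cmod_rev_triangle (inv1p z0) (average g inv1p N (RtoC x))) as Hr.
    rewrite Hh0 in Hr.
    assert (/ (1 + 2 * Cmod (1 + z0)) < / (2 * Cmod (1 + z0))).
    { apply Rinv_lt_contravar; [|lra]. apply Rmult_lt_0_compat; lra. }
    assert (/ Cmod (1 + z0) = / (2 * Cmod (1 + z0)) + / (2 * Cmod (1 + z0))) by (field; lra).
    lra.
Qed.

(** * The boundary near the point, and inversion *)

(** Differentiability of the first derivative at [0] bounds its increments linearly;
   the mean value theorem does the rest. *)
Lemma quadratic_expansion (h : R -> R) (r : R) : 0 < r -> C2_on h (- r) r ->
  exists A d, 0 < A /\ 0 < d /\ forall s, Rabs s < d ->
    Rabs (h s - h 0 - Derive h 0 * s) <= A * s ^ 2.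
Proof.
  intros Hr H2.
  assert (Hd1 : forall x, - r < x < r -> is_derive h x (Derive h x)).
  { intros x Hx. destruct (H2 x Hx) as [H _]. specialize (H 1%nat ltac:(lia)).
    apply Derive_correct. exact H. }
  assert (Hd2 : exists l, is_derive (Derive h) 0 l).
  { destruct (H2 0 ltac:(lra)) as [H _]. specialize (H 2%nat ltac:(lia)). exact H. }
  destruct Hd2 as [l Hl]. apply is_derive_Reals in Hl.
  destruct (Hl 1 Rlt_0_1) as [d Hd].
  set (A := Rabs l + 1). assert (HA : 0 < A) by (pose proof (Rabs_pos l); unfold A; lra).
  assert (Hlip : forall x, Rabs x < d -> Rabs (Derive h x - Derive h 0) <= A * Rabs x).
  { intros x Hx. destruct (Req_dec x 0) as [->|Hx0].
    - replace (Derive h 0 - Derive h 0) with 0 by ring. rewrite Rabs_R0. lra.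
    - specialize (Hd x Hx0 Hx). rewrite Rplus_0_l in Hd.
      replace (Derive h x - Derive h 0) with ((Derive h x - Derive h 0) / x * x)
        by (field; exact Hx0).
      rewrite Rabs_mult. apply Rmult_le_compat_r; [apply Rabs_pos|].
      replace ((Derive h x - Derive h 0) / x) with
        (l + ((Derive h x - Derive h 0) / x - l)) by ring.
      eapply Rle_trans; [apply Rabs_triang|]. unfold A. lra. }
  exists A, (Rmin d r). split; [exact HA|]. split; [apply Rmin_glb_lt; [apply cond_pos|exact Hr]|].
  intros s Hs.
  assert (Hs1 := Rlt_le_trans _ _ _ Hs (Rmin_l _ _)).
  assert (Hs2 := Rlt_le_trans _ _ _ Hs (Rmin_r _ _)).
  assert (Hin : forall x, Rmin 0 s <= x <= Rmax 0 s -> Rabs x <= Rabs s).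
  { intros x. unfold Rmin, Rmax, Rabs.
    destruct (Rle_dec 0 s), (Rcase_abs x), (Rcase_abs s); lra. }
  assert (Hder : forall x, Rmin 0 s <= x <= Rmax 0 s ->
    is_derive (fun x => h x - Derive h 0 * x) x (Derive h x - Derive h 0)).
  { intros x Hx. assert (Hxr : - r < x < r) by (destruct (Rabs_def2 x r); [specialize (Hin x Hx); lra|split; assumption]).
    apply (is_derive_minus (V := R_NormedModule)); [apply Hd1, Hxr|].
    auto_derive; trivial. ring. }
  destruct (MVT_gen (fun x => h x - Derive h 0 * x) 0 s (fun x => Derive h x - Derive h 0))
    as [c [Hc E]].
  - intros x Hx. apply Hder. lra.
  - intros x Hx. exact (is_derive_cont _ _ _ (Hder x Hx)).
  - replace (h s - h 0 - Derive h 0 * s) with (h s - Derive h 0 * s - (h 0 - Derive h 0 * 0)) by ring.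
    rewrite E, Rabs_mult, Rminus_0_r.
    replace (s ^ 2) with (Rabs s * Rabs s) by (rewrite <- Rabs_mult, Rabs_pos_eq; nra).
    rewrite <- Rmult_assoc. apply Rmult_le_compat_r; [apply Rabs_pos|].
    specialize (Hin c Hc).
    eapply Rle_trans; [apply Hlip; lra|]. apply Rmult_le_compat_l; lra.
Qed.

Lemma boundary_not_in (D : C -> Prop) p : open D -> boundary D p -> ~ D p.
Proof.
  intros HO HB HD. destruct (open_Cmod D p HO HD) as [r [Hr Hb]].
  destruct (HB r Hr) as [_ [z [Hz Hn]]]. apply Hn, Hb, Hz.
Qed.

Lemma Cmod_unimod_mult u w : Cmod u = 1 -> Cmod (u * w) = Cmod w.
Proof. intros H. rewrite Cmod_mult, H. ring. Qed.

Lemma Rabs_Im_le z : Rabs (Im z) <= Cmod z.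
Proof. exact (Rle_trans _ _ _ (Rmax_r _ _) (Rmax_Cmod z)). Qed.

(** In the coordinate [q] whose real axis is the inner normal, a disc
   tangent at [0] to the imaginary axis is given by [A |q| ^ 2 < Re q].  The graph deviates quadratically
   from its tangent line, so two such discs separate it on both sides. *)
Lemma tangent_discs (D : C -> Prop) p : open D -> boundary D p -> C2_boundary_near D p ->
  exists nu A d, Cmod nu = 1 /\ 0 < A /\ 0 < d /\ forall q, Cmod q < d ->
    (A * Cmod q ^ 2 < Re q -> D (p + nu * q)%C) /\
    (Re q < - (A * Cmod q ^ 2) -> ~ D (p + nu * q)%C).
Proof.
  intros HO HB (r & u & h & Hr & Hu & H2 & Hg).
  destruct (quadratic_expansion h r Hr H2) as (A & d & HA & Hd & Hq).
  assert (Hu0 : u <> 0) by (apply Cmod_gt_0; lra).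
  assert (Hh0 : h 0 = 0).
  { apply Rle_antisym.
    - apply Rnot_lt_le. intros Hpos.
      assert (Hc : continuity_pt h 0).
      { apply (is_derive_cont _ _ (Derive h 0)). apply Derive_correct.
        destruct (H2 0 ltac:(lra)) as [H _]. exact (H 1%nat ltac:(lia)). }
      destruct (Hc (h 0 / 2)) as [e [He Hce]]; [lra|].
      destruct (HB (Rmin (Rmin r e) (h 0 / 2))) as [[z [Hz HD]] _].
      { repeat apply Rmin_glb_lt; lra. }
      assert (Hz1 := Rlt_le_trans _ _ _ Hz (Rmin_l _ _)).
      assert (Hz2 := Rlt_le_trans _ _ _ Hz (Rmin_r _ _)).
      assert (Hz3 := Rlt_le_trans _ _ _ Hz1 (Rmin_l _ _)).
      assert (Hz4 := Rlt_le_trans _ _ _ Hz1 (Rmin_r _ _)).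
      set (w := ((z - p) / u)%C).
      assert (Hwz : z = (p + u * w)%C) by (unfold w; field; exact Hu0).
      assert (Hwm : Cmod w = Cmod (z - p)).
      { unfold w. rewrite Cmod_div, Hu by exact Hu0. field. }
      rewrite Hwz in HD. apply Hg in HD; [|lra].
      assert (Hre := re_le_Cmod w). assert (Him := Rabs_Im_le w). pose proof (Rle_abs (Im w)).
      assert (Hhw : h 0 / 2 < h (Re w)); [|lra].
      destruct (Req_dec (Re w) 0) as [->|Hre0]; [lra|].
      specialize (Hce (Re w)).
      assert (Hdx : Rabs (Re w - 0) < e) by (rewrite Rminus_0_r; lra).
      specialize (Hce (conj (conj I (not_eq_sym Hre0)) Hdx)).
      change (Rabs (h (Re w) - h 0) < h 0 / 2) in Hce.
      apply Rabs_def2 in Hce. lra.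
    - apply Rnot_lt_le. intros Hneg. apply (boundary_not_in D p HO HB).
      replace p with (p + u * 0)%C by ring. apply Hg; [rewrite Cmod_0; exact Hr|].
      exact Hneg. }
  set (k := Derive h 0) in *.
  (* The unit vector [v = (- k + i) / N] is normal to the line of slope [k] and points upwards, and
     [Im w - k Re w = N Re q] for [w = v q]. *)
  set (N := sqrt (1 + k ^ 2)).
  assert (HN1 : 1 <= N).
  { unfold N. rewrite <- sqrt_1 at 1. apply sqrt_le_1_alt. pose proof (pow2_ge_0 k). lra. }
  assert (HNN : N * N = 1 + k ^ 2).
  { apply sqrt_sqrt. pose proof (pow2_ge_0 k). lra. }
  set (v := ((- k / N)%R, (1 / N)%R) : C).
  assert (Hv : Cmod v = 1).
  { unfold Cmod, v. simpl fst. simpl snd. transitivity (sqrt 1); [f_equal|apply sqrt_1].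
    replace ((- k / N) ^ 2 + (1 / N) ^ 2) with ((1 + k ^ 2) / (N * N)) by (field; lra).
    rewrite <- HNN. field. lra. }
  exists (u * v)%C, A, (Rmin r d).
  split; [rewrite Cmod_mult, Hu, Hv; ring|]. split; [exact HA|].
  split; [apply Rmin_glb_lt; assumption|].
  intros q Hlt.
  assert (Hq1 := Rlt_le_trans _ _ _ Hlt (Rmin_l _ _)).
  assert (Hq2 := Rlt_le_trans _ _ _ Hlt (Rmin_r _ _)).
  set (w := (v * q)%C).
  assert (Hw : Cmod w = Cmod q) by (apply Cmod_unimod_mult, Hv).
  replace (p + u * v * q)%C with (p + u * w)%C by (unfold w; ring).
  rewrite Hg by lra.
  assert (Hdev : Im w - k * Re w = N * Re q).
  { unfold w, v, Re, Im. destruct q as [a b]. simpl.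
    transitivity ((1 + k ^ 2) / N * a); [field; lra|]. rewrite <- HNN. field. lra. }
  assert (Hre := re_le_Cmod w).
  specialize (Hq (Re w) ltac:(lra)). rewrite Hh0, Rminus_0_r in Hq.
  assert (Hsq : A * Re w ^ 2 <= A * Cmod q ^ 2).
  { apply Rmult_le_compat_l; [lra|]. rewrite <- Hw, <- (pow2_abs (Re w)).
    apply pow_incr. split; [apply Rabs_pos|exact Hre]. }
  apply Rcomplements.Rabs_le_between in Hq.
  assert (Hpos : 0 <= A * Cmod q ^ 2).
  { apply Rmult_le_pos; [lra|]. apply pow2_ge_0. }
  split; intros Hc.
  - assert (Re q <= N * Re q) by nra. lra.
  - assert (N * Re q <= Re q) by nra. lra.
Qed.

(** This turns the disc [A |q| ^ 2 < Re q] into the half-plane [A < Re (1 / q)]. *)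
Lemma Re_inv (z : C) : z <> 0 -> Re (/ z) = Re z * Cmod (/ z) ^ 2.
Proof.
  intros Hz. rewrite Cmod_inv, pow_inv, Cmod2_alt by exact Hz. reflexivity.
Qed.

Lemma open_preimage (U : C -> Prop) (f : C -> C) (a : C) : open U ->
  (forall z, z <> a -> exists l, cderiv f z l) -> open (fun z => z <> a /\ U (f z)).
Proof.
  intros HU Hf. apply Cmod_open. intros z [Hz HUz].
  destruct (open_Cmod U (f z) HU HUz) as [e [He Hb]].
  destruct (Hf z Hz) as [l Hl]. destruct (cderiv_cont f z l Hl e He) as [d [Hd Hc]].
  assert (Hm : 0 < Cmod (a - z)).
  { apply Cmod_gt_0. intro E. apply Hz. symmetry. apply Cminus_eq_0, E. }
  exists (Rmin d (Cmod (a - z))). split; [apply Rmin_glb_lt; assumption|].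
  intros v Hv. split.
  - intros ->. pose proof (Rlt_le_trans _ _ _ Hv (Rmin_r _ _)). lra.
  - apply Hb, Hc. exact (Rlt_le_trans _ _ _ Hv (Rmin_l _ _)).
Qed.

(** The nonemptiness of [S] is what makes the infimum a real number. *)
Lemma dist_to_lower (S : C -> Prop) z b m : S b -> 0 <= m ->
  (forall w, S w -> m <= Cmod (z - w)) -> m <= dist_to z S.
Proof.
  intros Hb Hm H. unfold dist_to.
  destruct (Glb_Rbar_correct (fun x => exists w, S w /\ x = Cmod (z - w))) as [H1 H2].
  specialize (H1 (Cmod (z - b)) (ex_intro _ b (conj Hb eq_refl))).
  specialize (H2 (Finite m)).
  destruct (Glb_Rbar _) as [y| |]; simpl in *; try contradiction.
  - apply H2. intros x [w [Hw ->]]. apply H, Hw.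
  - exfalso. apply H2. intros x [w [Hw ->]]. apply H, Hw.
Qed.

Lemma little_o_elim (D : C -> Prop) p f M eps : 1 < M -> 0 < eps ->
  nontangential_little_o D p (fun z => f z - z)%C (fun z => RtoC (Cmod (z - p))) ->
  exists d, 0 < d /\ forall z, Cmod (z - p) < d -> approach_region D p M z -> z <> p ->
    Cmod (f z - z) <= eps * Cmod (z - p).
Proof.
  intros HM He H. specialize (H M HM).
  apply (proj1 (filterlim_locally _ _)) with (eps := mkposreal (eps / 2) ltac:(lra)) in H.
  destruct H as [d Hd]. exists d. split; [apply cond_pos|].
  intros z Hz Happ Hne. specialize (Hd z (C_NormedModule_mixin_compat1 p z d Hz) Happ).
  apply C_NormedModule_mixin_compat2 in Hd.
  assert (Hm : 0 < Cmod (z - p)).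
  { apply Cmod_gt_0. intro E. apply Hne, Cminus_eq_0, E. }
  change (Cmod ((f z - z) / RtoC (Cmod (z - p)) - 0) < sqrt 2 * (eps / 2)) in Hd.
  replace ((f z - z) / RtoC (Cmod (z - p)) - 0)%C with ((f z - z) / RtoC (Cmod (z - p)))%C in Hd
    by (unfold Cdiv; ring).
  rewrite Cmod_div, Cmod_R, Rabs_pos_eq in Hd by (try apply RtoC_neq; lra).
  assert (Hs : sqrt 2 <= 2).
  { rewrite <- (sqrt_square 2) at 2 by lra. apply sqrt_le_1_alt. lra. }
  apply Rlt_le, (proj1 (Rle_div_l (Cmod (f z - z)) _ _ Hm)) in Hd.
  eapply Rle_trans; [exact Hd|]. apply Rmult_le_compat_r; nra.
Qed.

Section Inversion.

Variables (D : C -> Prop) (p nu : C) (A d : R).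
Hypothesis D_open : open D.
Hypothesis p_bd : boundary D p.
Hypothesis nu_mod : Cmod nu = 1.
Hypothesis A_pos : 0 < A.
Hypothesis d_pos : 0 < d.
Hypothesis discs : forall q, Cmod q < d ->
    (A * Cmod q ^ 2 < Re q -> D (p + nu * q)%C) /\
    (Re q < - (A * Cmod q ^ 2) -> ~ D (p + nu * q)%C).

(* Up to the factor [nu] and the shift by [B], which moves [E] into the right half-plane,
   [W] is the inversion at [p], and [Z] is its inverse. *)
Let B : R := Rmax A (/ d) + 1.
Let Z (v : C) : C := (p + nu * / (v - RtoC B))%C.
Let W (z : C) : C := (RtoC B + nu * / (z - p))%C.
Let E (v : C) : Prop := v <> RtoC B /\ D (Z v).

Lemma B_lower : A + 1 <= B /\ / d + 1 <= B.
Proof.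
  unfold B. pose proof (Rmax_l A (/ d)). pose proof (Rmax_r A (/ d)). lra.
Qed.

Lemma sub_neq (a b : C) : a <> b -> (a - b <> 0)%C.
Proof. intros H E0. apply H, Cminus_eq_0, E0. Qed.

Lemma nu_neq : nu <> 0.
Proof. apply Cmod_gt_0. lra. Qed.

Lemma Z_neq v : v <> RtoC B -> Z v <> p.
Proof.
  intros Hv E0. apply sub_neq in Hv. apply (f_equal (fun z => (z - p) * (v - RtoC B))%C) in E0.
  unfold Z in E0. apply nu_neq. transitivity ((p - p) * (v - RtoC B))%C; [|ring].
  rewrite <- E0. field. exact Hv.
Qed.

Lemma W_neq z : z <> p -> W z <> RtoC B.
Proof.
  intros Hv E0. apply sub_neq in Hv. apply (f_equal (fun v => (v - RtoC B) * (z - p))%C) in E0.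
  unfold W in E0. apply nu_neq. transitivity ((RtoC B - RtoC B) * (z - p))%C; [|ring].
  rewrite <- E0. field. exact Hv.
Qed.

Lemma Z_W z : z <> p -> Z (W z) = z.
Proof.
  intros Hz. apply sub_neq in Hz. unfold Z, W.
  replace (RtoC B + nu * / (z - p) - RtoC B)%C with (nu * / (z - p))%C by ring.
  field. split; [exact Hz|apply nu_neq].
Qed.

Lemma W_Z v : v <> RtoC B -> W (Z v) = v.
Proof.
  intros Hv. apply sub_neq in Hv. unfold Z, W.
  replace (p + nu * / (v - RtoC B) - p)%C with (nu * / (v - RtoC B))%C by ring.
  field. split; [exact Hv|apply nu_neq].
Qed.

Lemma Z_diff v : v <> RtoC B -> exists l, cderiv Z v l.
Proof.
  intros Hv. eexists. apply cderiv_plus; [apply cderiv_const|].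
  apply cderiv_mult; [apply cderiv_const|].
  apply (cderiv_comp Cinv (fun v => v - RtoC B)%C); [apply cderiv_inv, sub_neq, Hv|].
  apply cderiv_minus; [apply cderiv_id|apply cderiv_const].
Qed.

Lemma W_diff z : z <> p -> exists l, cderiv W z l.
Proof.
  intros Hv. eexists. apply cderiv_plus; [apply cderiv_const|].
  apply cderiv_mult; [apply cderiv_const|].
  apply (cderiv_comp Cinv (fun v => v - p)%C); [apply cderiv_inv, sub_neq, Hv|].
  apply cderiv_minus; [apply cderiv_id|apply cderiv_const].
Qed.

Lemma D_neq z : D z -> z <> p.
Proof. intros Hz ->. exact (boundary_not_in D p D_open p_bd Hz). Qed.

Lemma W_in z : D z -> E (W z).
Proof.
  intros Hz. assert (Hp := D_neq z Hz). split; [apply W_neq, Hp|].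
  rewrite Z_W by exact Hp. exact Hz.
Qed.

Lemma E_open : open E.
Proof. apply open_preimage; [exact D_open|apply Z_diff]. Qed.

Lemma E_connected : connected_set D -> connected_set E.
Proof.
  intros HC U V HU HV Hcov [a [[Ha1 Ha2] HaU]] [b [[Hb1 Hb2] HbV]].
  destruct (HC (fun z => z <> p /\ U (W z)) (fun z => z <> p /\ V (W z))) as [z [Hz [HzU HzV]]].
  - apply open_preimage; [exact HU|apply W_diff].
  - apply open_preimage; [exact HV|apply W_diff].
  - intros z Hz. assert (Hp := D_neq z Hz).
    destruct (Hcov (W z) (W_in z Hz)); [left|right]; split; assumption.
  - exists (Z a). split; [exact Ha2|]. split; [apply Z_neq, Ha1|]. rewrite W_Z; assumption.
  - exists (Z b). split; [exact Hb2|]. split; [apply Z_neq, Hb1|]. rewrite W_Z; assumption.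
  - exists (W z). split; [apply W_in, Hz|]. split; [apply HzU|apply HzV].
Qed.

Lemma inverse_small v : B - 1 < Rabs (Re (v - RtoC B)) ->
  (v - RtoC B <> 0)%C /\ Cmod (/ (v - RtoC B)) < d /\ 0 < Cmod (/ (v - RtoC B)).
Proof.
  intros H. pose proof B_lower as [_ HB].
  pose proof (re_le_Cmod (v - RtoC B)%C) as Hre.
  assert (Hdi : 0 < / d) by (apply Rinv_0_lt_compat, d_pos).
  assert (Hn : (v - RtoC B <> 0)%C) by (apply Cmod_gt_0; lra).
  assert (Hm : 0 < Cmod (v - RtoC B)) by (apply Cmod_gt_0, Hn).
  split; [exact Hn|]. rewrite Cmod_inv by exact Hn. split.
  - rewrite <- (Rinv_inv d). apply Rinv_lt_contravar; [apply Rmult_lt_0_compat; assumption|lra].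
  - apply Rinv_0_lt_compat, Hm.
Qed.

Lemma E_pos v : E v -> 0 < Re v.
Proof.
  intros [_ HD]. apply Rnot_le_lt. intros Hv. pose proof B_lower as [HB1 HB2].
  assert (Hre : Re (v - RtoC B) = Re v - B) by (unfold Re; simpl; ring).
  destruct (inverse_small v) as (Hn & Hd & Hp).
  { rewrite Hre, Rabs_left; lra. }
  apply (proj2 (discs _ Hd)); [|exact HD].
  rewrite (Re_inv _ Hn), Hre.
  assert (0 < Cmod (/ (v - RtoC B)) ^ 2) by (apply pow_lt, Hp). nra.
Qed.

Lemma E_half_plane v : 2 * B < Re v -> E v.
Proof.
  intros Hv. pose proof B_lower as [HB1 HB2].
  assert (Hre : Re (v - RtoC B) = Re v - B) by (unfold Re; simpl; ring).
  destruct (inverse_small v) as (Hn & Hd & Hp).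
  { rewrite Hre, Rabs_pos_eq; lra. }
  split.
  - intros ->. unfold Re in Hv. simpl in Hv. lra.
  - apply (proj1 (discs _ Hd)). rewrite (Re_inv _ Hn), Hre.
    assert (0 < Cmod (/ (v - RtoC B)) ^ 2) by (apply pow_lt, Hp). nra.
Qed.

(** Inversion maps the disc of centre [x] and radius [x / 2] well inside the inner
   tangent disc: if [q] is the image of a point of it, the whole disc of radius [|q| / 16]
   about [q] is in the image of the domain.  Hence the distance to the boundary is at least
   [|q| / 16], and any aperture above [16] will do. *)
Lemma Stolz_region x v : 4 * B < x -> 256 * A < x -> 8 / d < x ->
  Cmod (v - RtoC x) <= x / 2 ->
  E v /\ x / 4 <= Cmod (v - RtoC B) <= 2 * x /\ approach_region D p 17 (Z v).
Proof.
  intros Hx1 Hx2 Hx3 Hv. pose proof B_lower as [HB1 HB2].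
  pose proof (re_le_Cmod (v - RtoC x)%C) as Hr.
  replace (Re (v - RtoC x)) with (Re v - x) in Hr by (unfold Re; simpl; ring).
  apply Rcomplements.Rabs_le_between in Hr.
  set (eta := (v - RtoC B)%C).
  assert (Hre : Re eta = Re v - B) by (unfold eta, Re; simpl; ring).
  assert (Hre4 : x / 4 <= Re eta) by lra.
  assert (Hlo : x / 4 <= Cmod eta).
  { pose proof (re_le_Cmod eta). pose proof (Rle_abs (Re eta)). lra. }
  assert (Hup : Cmod eta <= 2 * x).
  { replace eta with ((v - RtoC x) + RtoC (x - B))%C
      by (unfold eta; rewrite RtoC_minus; ring).
    eapply Rle_trans; [apply Cmod_triangle|]. rewrite Cmod_R, Rabs_pos_eq; lra. }
  assert (HvB : v <> RtoC B).
  { intros ->. unfold eta in Hlo. replace (RtoC B - RtoC B)%C with (RtoC 0) in Hlo by ring.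
    rewrite Cmod_0 in Hlo. lra. }
  assert (Hn : eta <> 0) by (apply sub_neq, HvB).
  set (q := (/ eta)%C).
  assert (Hqm : Cmod q = / Cmod eta) by (apply Cmod_inv, Hn).
  assert (Hq0 : 0 < Cmod q) by (rewrite Hqm; apply Rinv_0_lt_compat; lra).
  assert (Hqx : Cmod q * x <= 4).
  { rewrite Hqm. apply Rmult_le_reg_l with (Cmod eta); [lra|].
    rewrite <- Rmult_assoc, Rinv_r by lra. lra. }
  assert (Hqre : Cmod q / 8 <= Re q).
  { unfold q. rewrite (Re_inv _ Hn). fold q.
    assert (Cmod q * Cmod eta = 1) by (rewrite Hqm; field; lra).
    assert (Cmod eta / 8 <= Re eta) by lra.
    assert (Cmod eta / 8 * Cmod q ^ 2 <= Re eta * Cmod q ^ 2).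
    { apply Rmult_le_compat_r; [apply pow2_ge_0|assumption]. }
    simpl in *. nra. }
  assert (HqA : 64 * A * Cmod q < 1).
  { assert (Cmod q * (256 * A) < Cmod q * x) by (apply Rmult_lt_compat_l; assumption). lra. }
  assert (Hqd : 2 * Cmod q < d).
  { assert (8 < d * x).
    { apply Rlt_div_l in Hx3; lra. }
    assert (Cmod q * x < d / 2 * x) by lra.
    apply Rmult_lt_reg_r in H0; lra. }
  assert (HZp : (Z v - p)%C = (nu * q)%C) by (unfold Z; fold eta q; ring).
  assert (HZm : Cmod (Z v - p) = Cmod q) by (rewrite HZp; apply Cmod_unimod_mult, nu_mod).
  assert (Hnear : forall b, Cmod (Z v - b) < Cmod q / 16 -> D b).
  { intros b Hb. set (qb := ((b - p) / nu)%C).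
    assert (Eb : b = (p + nu * qb)%C) by (unfold qb; field; apply nu_neq).
    assert (Hqb : Cmod (qb - q) < Cmod q / 16).
    { rewrite Cmod_minus_sym, <- (Cmod_unimod_mult nu) by exact nu_mod.
      replace (nu * (q - qb))%C with (Z v - b)%C; [exact Hb|].
      rewrite Eb. unfold Z. fold eta q. ring. }
    pose proof (re_le_Cmod (qb - q)%C) as Hrb.
    replace (Re (qb - q)) with (Re qb - Re q) in Hrb by (unfold Re; simpl; ring).
    apply Rcomplements.Rabs_le_between in Hrb.
    assert (Hqb2 : Cmod qb <= 2 * Cmod q).
    { pose proof (Cmod_rev_triangle qb q). lra. }
    rewrite Eb. apply discs; [lra|].
    assert (Cmod qb ^ 2 <= (2 * Cmod q) ^ 2).
    { apply pow_incr. split; [apply Cmod_ge_0|exact Hqb2]. }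
    assert (A * Cmod qb ^ 2 <= A * (2 * Cmod q) ^ 2) by (apply Rmult_le_compat_l; lra).
    assert (A * (2 * Cmod q) ^ 2 < Cmod q / 16) by nra. lra. }
  assert (HDZ : D (Z v)).
  { apply Hnear. replace (Z v - Z v)%C with (RtoC 0) by ring. rewrite Cmod_0. lra. }
  split; [split; assumption|]. split; [split; assumption|]. split; [exact HDZ|].
  assert (Hdist : Cmod q / 16 <= dist_to (Z v) (boundary D)).
  { apply dist_to_lower with (b := p); [exact p_bd|lra|].
    intros b Hb. apply Rnot_lt_le. intros Hlt.
    exact (boundary_not_in D b D_open Hb (Hnear b Hlt)). }
  rewrite HZm. lra.
Qed.

Variables (f : C -> C) (z0 : C).
Hypothesis D_conn : connected_set D.
Hypothesis f_self : forall z, D z -> D (f z).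
Hypothesis f_diff : forall z, D z -> exists l, cderiv f z l.
Hypothesis z0_in : D z0.
Hypothesis z0_fix : f z0 = z0.
Hypothesis f_o : nontangential_little_o D p
  (fun z => f z - z)%C (fun z => RtoC (Cmod (z - p))).

(** With [m = |z - p|], the inversion of a point at distance [o(m)] from [z] moves by
   [o(m) / m ^ 2 = o(1 / m)], and [1 / m] is comparable to [x]. *)
Lemma inverted_asymptotics eps : 0 < eps -> exists X, forall x v, X < x ->
  Cmod (v - RtoC x) <= x / 2 -> Cmod (W (f (Z v)) - v) <= eps * x.
Proof.
  intros He. pose proof B_lower as [HB1 HB2].
  (* The bound [1 / 2] keeps [|f z - p|] above [m / 2]; the other one absorbs this factor
     and the one in [|v - B| <= 2 x]. *)
  set (e := Rmin (1 / 2) (eps / 4)).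
  assert (He0 : 0 < e) by (apply Rmin_glb_lt; lra).
  assert (He1 : e <= 1 / 2) by apply Rmin_l.
  assert (He2 : e <= eps / 4) by apply Rmin_r.
  destruct (little_o_elim D p f 17 e ltac:(lra) He0 f_o) as [s [Hs Ho]].
  exists (Rmax (Rmax (4 * B) (256 * A)) (Rmax (8 / d) (4 / s))).
  intros x v Hx Hv.
  assert (Hx1 := Rle_lt_trans _ _ _ (Rmax_l _ _) Hx).
  assert (Hx2 := Rle_lt_trans _ _ _ (Rmax_r _ _) Hx).
  assert (Hxa := Rle_lt_trans _ _ _ (Rmax_l _ _) Hx1).
  assert (Hxb := Rle_lt_trans _ _ _ (Rmax_r _ _) Hx1).
  assert (Hxc := Rle_lt_trans _ _ _ (Rmax_l _ _) Hx2).
  assert (Hxd := Rle_lt_trans _ _ _ (Rmax_r _ _) Hx2).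
  destruct (Stolz_region x v Hxa Hxb Hxc Hv) as ((HvB & HD) & [Hlo Hup] & Happ).
  assert (Hx0 : 0 < x) by lra.
  assert (Hn := sub_neq _ _ HvB).
  assert (HZp : (Z v - p)%C = (nu * / (v - RtoC B))%C) by (unfold Z; ring).
  assert (HZm : Cmod (Z v - p) = / Cmod (v - RtoC B)).
  { rewrite HZp, Cmod_unimod_mult, Cmod_inv; trivial. }
  assert (HZs : Cmod (Z v - p) < s).
  { rewrite HZm. apply Rlt_div_l in Hxd; [|exact Hs].
    apply Rmult_lt_reg_l with (Cmod (v - RtoC B)); [lra|]. rewrite Rinv_r by lra. nra. }
  specialize (Ho (Z v) HZs Happ (Z_neq v HvB)).
  set (m := Cmod (Z v - p)) in *.
  assert (Hm0 : 0 < m) by (rewrite HZm; apply Rinv_0_lt_compat; lra).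
  assert (Hfp : m / 2 <= Cmod (f (Z v) - p)).
  { replace (f (Z v) - p)%C with ((Z v - p) - (Z v - f (Z v)))%C by ring.
    eapply Rle_trans; [|apply Cmod_rev_triangle]. fold m.
    rewrite (Cmod_minus_sym (Z v)). nra. }
  assert (Hf0 := D_neq _ (f_self _ HD)). apply sub_neq in Hf0.
  assert (Hz0 := sub_neq _ _ (Z_neq v HvB)).
  rewrite <- (W_Z v HvB) at 2. unfold W.
  replace (RtoC B + nu * / (f (Z v) - p) - (RtoC B + nu * / (Z v - p)))%C with
    (nu * ((Z v - f (Z v)) / ((f (Z v) - p) * (Z v - p))))%C by (field; split; assumption).
  rewrite Cmod_unimod_mult, Cmod_div, Cmod_mult by (try apply Cmult_neq_0; assumption).
  rewrite Cmod_minus_sym. fold m.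
  apply Rle_trans with (e * m / (m / 2 * m)).
  - apply Rmult_le_compat; [apply Cmod_ge_0| |exact Ho|].
    + apply Rlt_le, Rinv_0_lt_compat, Rmult_lt_0_compat; lra.
    + apply Rinv_le_contravar; [apply Rmult_lt_0_compat; lra|].
      apply Rmult_le_compat_r; lra.
  - replace (e * m / (m / 2 * m)) with (2 * e * / m) by (field; lra).
    rewrite HZm, Rinv_inv.
    apply Rle_trans with (2 * e * (2 * x)); [apply Rmult_le_compat_l; lra|].
    replace (2 * e * (2 * x)) with (4 * e * x) by ring. apply Rmult_le_compat_r; lra.
Qed.

Lemma rigidity_of_tangent_discs : forall z, D z -> f z = z.
Proof.
  intros z Hz.
  assert (H : W (f (Z (W z))) = W z).
  { apply (half_plane_rigidity E (fun v => W (f (Z v))) (W z0) (2 * B)).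
    - apply E_open.
    - apply E_connected, D_conn.
    - apply E_pos.
    - apply E_half_plane.
    - intros v [_ HD]. apply W_in, f_self, HD.
    - intros v [HvB HD]. destruct (Z_diff v HvB) as [a Ha].
      destruct (f_diff _ HD) as [b Hb].
      destruct (W_diff _ (D_neq _ (f_self _ HD))) as [c Hc].
      eexists. apply (cderiv_comp W (fun v => f (Z v))); [exact Hc|].
      apply (cderiv_comp f Z); [exact Hb|exact Ha].
    - apply W_in, z0_in.
    - rewrite Z_W, z0_fix; [reflexivity|]. apply D_neq, z0_in.
    - apply inverted_asymptotics.
    - apply W_in, Hz. }
  assert (Hp := D_neq z Hz). rewrite Z_W in H by exact Hp.
  rewrite <- (Z_W (f z)), H, Z_W; trivial.
  apply D_neq, f_self, Hz.
Qed.

End Inversion.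

Local Close Scope R_scope.

Theorem corollary2p8 :
  forall (D : C -> Prop) (p : C) (f : C -> C) (z0 : C),
    is_domain D ->
    boundary D p ->
    C2_boundary_near D p ->
    (forall z : C, D z -> D (f z)) ->
    holomorphic_on D f ->
    D z0 ->
    f z0 = z0 ->
    nontangential_little_o D p
      (fun z : C => f z - z) (fun z : C => RtoC (Cmod (z - p))) ->
    forall z : C, D z -> f z = z.
Proof.
  intros D p f z0 (_ & HO & HC) HB H2 Hself Hhol Hz0 Hfix Ho.
  destruct (tangent_discs D p HO HB H2) as (nu & A & d & Hnu & HA & Hd & Hdiscs).
  apply (rigidity_of_tangent_discs D p nu A d HO HB Hnu HA Hd Hdiscs f z0 HC Hself); try assumption.
  intros z Hz. apply ex_derive_cderiv, Hhol, Hz.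
Qed.
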